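(* For every superscheme $S$ with $R=\Gamma(S,\mathcal O_S)$, the map sending a superconformal automorphism $(z|\zeta)\mapsto(\hat z|\hat\zeta)=(u+\zeta\omega\,|\,\eta+\zeta v)$ to the pair $(u+\zeta\eta,\,v)$ is a bijection, natural in $S$, $$\psi_S:\mathrm{SWitt}(S)\xrightarrow{\sim}\widetilde{\Gamma^1_{0/2}}(S):=\{(u+\zeta\eta,\,v)\in\Gamma^1_{0/2}(S)\times R_0((z)) : v^2=u'+\eta\eta'\},$$ where $u\in R_0((z))$, $\eta\in R_1((z))$ and $'$ denotes $d/dz$.
   Context: $z$ even, $\zeta$ odd. $\Gamma^1_{0/2}(S)$ is the set of even elements $\sum_{n\ge-M}(a_n+\alpha_n\zeta)z^n$ of $R((z))[\zeta]$ ($a_n\in R_0,\alpha_n\in R_1$, some $M$) with $a_1\in R_0^\times$ and $a_n$ nilpotent for all $n<1$. $\mathrm{SWitt}(S)$ is the set of $R$-algebra automorphisms $\phi$ of $R((z))[\zeta]$ that are homeomorphisms for the $z$-adic topology (continuity: for each $M$ there is $N$ with $\phi(z^N R[[z]][\zeta])\subset z^MR[[z]][\zeta]$) and are superconformal: $\phi^*D_\zeta=FD_\zeta$ for some $F$, where $D_\zeta=\partial_\zeta+\zeta\partial_z$. Such $\phi$ is determined by $\hat z=\phi(z)=u(z)+\zeta\omega(z)$ and $\hat\zeta=\phi(\zeta)=\eta(z)+\zeta v(z)$, and superconformality is equivalent to $D_\zeta\hat z=\hat\zeta D_\zeta\hat\zeta$, i.e.\ $\omega=\eta v$ and $u'=v^2-\eta\eta'$.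 *)

(* Defs.v *)
From HB Require Import structures.
From mathcomp Require Import all_boot all_order all_algebra.
From Stdlib Require Import ClassicalEpsilon.
Set Implicit Arguments.
Unset Strict Implicit.
Unset Printing Implicit Defensive.
Import Order.TTheory GRing.Theory Num.Theory.
Local Open Scope ring_scope.

(* Supercommutative rings R = R_0 (+) R_1, given by the two (additive) *)
(* projections ev : R -> R_0 and od : R -> R_1.                        *)
Record superring (R : pzRingType) (ev od : {additive R -> R}) : Prop := {
  sr_decomp : forall x, ev x + od x = x;
  sr_evev : forall x, ev (ev x) = ev x;
  sr_odod : forall x, od (od x) = od x;
  sr_evod : forall x, ev (od x) = 0;
  sr_odev : forall x, od (ev x) = 0;
  sr_ev1 : ev 1 = 1;
  sr_mul_ee : forall x y, od (ev x * ev y) = 0;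
  sr_mul_eo : forall x y, ev (ev x * od y) = 0;
  sr_mul_oe : forall x y, ev (od x * ev y) = 0;
  sr_mul_oo : forall x y, od (od x * od y) = 0;
  sr_even_central : forall x y, ev x * y = y * ev x;
  sr_odd_anticomm : forall x y, od x * od y = - (od y * od x);
  sr_odd_sq : forall x, od x * od x = 0 }.

Definition is_laurent (R : pzRingType) (c : int -> R) :=
  exists M : int, forall n : int, n < M -> c n = 0.

Definition laurent (R : pzRingType) := {c : int -> R | is_laurent c}.

Definition lcoef (R : pzRingType) (f : laurent R) : int -> R := proj1_sig f.

Definition lbound (R : pzRingType) (f : laurent R) : int :=
  proj1_sig (constructive_indefinite_description _ (proj2_sig f)).

Lemma lboundP (R : pzRingType) (f : laurent R) n : n < lbound f -> lcoef f n = 0.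
Proof.
rewrite /lbound; case: constructive_indefinite_description => M HM /=; exact: HM.
Qed.

Lemma is_laurent_map (R R' : pzRingType) (h : R -> R') (f : laurent R) :
  h 0 = 0 -> is_laurent (fun n => h (lcoef f n)).
Proof. by move=> h0; exists (lbound f) => n /lboundP ->. Qed.

Lemma is_laurent_pw (R : pzRingType) (op : R -> R -> R) (f g : laurent R) :
  op 0 0 = 0 -> is_laurent (fun n => op (lcoef f n) (lcoef g n)).
Proof.
move=> h0; exists (Order.min (lbound f) (lbound g)) => n.
by rewrite lt_min => /andP[/lboundP -> /lboundP ->].
Qed.

Section LaurentOps.
Variable R : pzRingType.

Definition lmap (R' : pzRingType) (h : {additive R -> R'}) (f : laurent R)
  : laurent R' := exist _ _ (@is_laurent_map R R' h f (raddf0 h)).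

Definition ladd (f g : laurent R) : laurent R :=
  exist _ _ (@is_laurent_pw R (@GRing.add R) f g (addr0 0)).

Definition lscale (r : R) (f : laurent R) : laurent R :=
  exist _ _ (@is_laurent_map R R (fun x => r * x) f (mulr0 r)).

Lemma is_laurent_const (a : R) (k : int) :
  is_laurent (fun n : int => if n == k then a else 0).
Proof. by exists k => n hn; rewrite lt_eqF. Qed.

Definition lzero : laurent R := exist _ _ (@is_laurent_const 0 0).
Definition lone : laurent R := exist _ _ (@is_laurent_const 1 0).
Definition lz : laurent R := exist _ _ (@is_laurent_const 1 1).

(* product: (fg)_n = sum_{i+j=n} f_i g_j (a finite sum) *)
Definition lmul_coef (f g : laurent R) (n : int) : R :=
  let a := lbound f in let b := lbound g in
  if a + b <= n then
    \sum_(k < (absz (n - a - b)%R).+1) lcoef f (a + (k : nat)%:Z) * lcoef g (n - a - (k : nat)%:Z)%R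
  else 0.

Lemma is_laurent_mul (f g : laurent R) : is_laurent (lmul_coef f g).
Proof. by exists (lbound f + lbound g) => n hn; rewrite /lmul_coef /= leNgt hn. Qed.

Definition lmul (f g : laurent R) : laurent R := exist _ _ (is_laurent_mul f g).

Lemma is_laurent_der (f : laurent R) :
  is_laurent (fun n : int => lcoef f (n + 1) *~ (n + 1)).
Proof.
exists (lbound f - 1) => n hn; rewrite lboundP ?mul0rz //.
by rewrite -ltrBrDr.
Qed.

Definition lder (f : laurent R) : laurent R := exist _ _ (is_laurent_der f).

End LaurentOps.

(* The superalgebra R((z))[zeta], zeta odd, zeta^2 = 0.  A pair (f, g) *)
(* represents f + g zeta, i.e. sum_n (f_n + g_n zeta) z^n.             *)
Section Super.
Variables (R : pzRingType) (ev od : {additive R -> R}).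

Definition LS := (laurent R * laurent R)%type.

Definition is_even (c : R) := ev c = c.
Definition is_odd (c : R) := od c = c.

Definition spar (c : R) : R := ev c - od c.
Lemma spar0 : spar 0 = 0. Proof. by rewrite /spar (raddf0 ev) (raddf0 od) subrr. Qed.
Definition lsig (f : laurent R) : laurent R := exist _ _ (@is_laurent_map R R spar f spar0).

Definition ls_add (x y : LS) : LS := (ladd x.1 y.1, ladd x.2 y.2).
(* (f1 + g1 zeta)(f2 + g2 zeta) = f1 f2 + (f1 g2 + g1 sigma(f2)) zeta *)
Definition ls_mul (x y : LS) : LS :=
  (lmul x.1 y.1, ladd (lmul x.1 y.2) (lmul x.2 (lsig y.1))).
Definition ls_scale (r : R) (x : LS) : LS := (lscale r x.1, lscale r x.2).
Definition ls_one : LS := (lone R, lzero R).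
Definition ls_z : LS := (lz R, lzero R).
Definition ls_zeta : LS := (lzero R, lone R).
Definition ls_of (f : laurent R) : LS := (f, lzero R).

(* the coefficient b in the decomposition x = a + zeta b (a = x.1) *)
Definition zcoef (x : LS) : laurent R := lsig x.2.

(* D_zeta = d/dzeta + zeta d/dz :  D(f + g zeta) = sigma(g) + sigma(f') zeta *)
Definition ls_D (x : LS) : LS := (lsig x.2, lsig (lder x.1)).

Definition ls_even (x : LS) :=
  (forall n, is_even (lcoef x.1 n)) /\ (forall n, is_odd (lcoef x.2 n)).
Definition ls_odd (x : LS) :=
  (forall n, is_odd (lcoef x.1 n)) /\ (forall n, is_even (lcoef x.2 n)).

Definition in_zM (M : int) (x : LS) :=
  forall n, n < M -> lcoef x.1 n = 0 /\ lcoef x.2 n = 0.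

Definition ls_continuous (phi : LS -> LS) :=
  forall M : int, exists N : int, forall x, in_zM N x -> in_zM M (phi x).

(* SWitt(S): continuous (even) R-algebra automorphisms with continuous
   inverse which are superconformal: phi^* D_zeta = F D_zeta, where
   phi^* D_zeta := phi^{-1} o D_zeta o phi. *)
Definition SWitt (phi : LS -> LS) : Prop :=
  (forall x y, phi (ls_add x y) = ls_add (phi x) (phi y)) /\
  (forall (r : R) x, phi (ls_scale r x) = ls_scale r (phi x)) /\
  (forall x y, phi (ls_mul x y) = ls_mul (phi x) (phi y)) /\
  phi ls_one = ls_one /\
  (forall x, ls_even x -> ls_even (phi x)) /\
  (forall x, ls_odd x -> ls_odd (phi x)) /\
  ls_continuous phi /\
  exists phiinv : LS -> LS,
    cancel phi phiinv /\ cancel phiinv phi /\ ls_continuous phiinv /\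
    exists F : LS, forall x, phiinv (ls_D (phi x)) = ls_mul F (ls_D x).

Definition Gamma1_02 (w : LS) : Prop :=
  ls_even w /\
  (exists b : R, is_even b /\ lcoef w.1 1 * b = 1 /\ b * lcoef w.1 1 = 1) /\
  (forall n : int, n < 1 -> exists k : nat, lcoef w.1 n ^+ k = 0).

Definition laurent_even (v : laurent R) := forall n, is_even (lcoef v n).

Definition GammaTilde (p : LS * laurent R) : Prop :=
  let w := p.1 in let v := p.2 in
  let u := w.1 in let eta := zcoef w in
  Gamma1_02 w /\ laurent_even v /\
  lmul v v = ladd (lder u) (lmul eta (lder eta)).

Definition psiS (phi : LS -> LS) : LS * laurent R :=
  let zh := phi ls_z in let zth := phi ls_zeta in
  let u := zh.1 in let eta := zth.1 in let v := zcoef zth in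
  (ls_add (ls_of u) (ls_mul ls_zeta (ls_of eta)), v).

End Super.

Definition mapLS (R R' : pzRingType) (f : {additive R -> R'}) (x : LS R) : LS R' :=
  (lmap f x.1, lmap f x.2).

(* Main.v *)
(** A continuous algebra endomorphism of [R((z))[zeta]] is determined by the images
    [Z] of [z] and [T] of [zeta], and it is superconformal iff [D Z = T (D T)], which
    expresses the odd component of [Z] and the derivative of its even component
    through [T]. This gives injectivity and the equation [v^2 = u' + eta eta'].
    Continuity makes [Z] topologically nilpotent, so the coefficients [u_n], [n < 1],
    are nilpotent; comparing coefficients of [z] in [phi (phi^-1 z) = z] modulo
    nilpotents shows that [u_1] is a unit.

    Conversely, substitution of a pair [(Z, T)] converges because [Z] is topologically
    nilpotent, and the point is that it is bijective with continuous inverse.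
    Removing a coefficient that is divisible by a homogeneous nilpotent [r] changes
    the substitution by an operator with values in [r A], which does not affect
    invertibility. After finitely many such steps [Z = u_1 z + O(z^2)] and
    [T = v_0 zeta + O(z)], and the substitution is triangular for the [z]-adic
    filtration with invertible diagonal. Identities between continuous additive
    operations (associativity, Leibniz and chain rules, multiplicativity of the
    substitution) are all checked on monomials only. *)

Require Import Defs.
From HB Require Import structures.
From mathcomp Require Import all_boot all_order all_algebra.
From mathcomp Require Import boolp zify.
Set Implicit Arguments.
Unset Strict Implicit.
Unset Printing Implicit Defensive.
Import Order.TTheory GRing.Theory Num.Theory.
Local Open Scope ring_scope.

(** * Laurent series *)

(** The conditions on a pair bear on [u] and on [v^2], whereas substitution needs control of [v]
    itself. The bridge is the ideal of elements with nilpotent even part: it contains every odd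
    element and its quotient is reduced, so modulo it the equation reads [v^2 = u']. This forces
    [v_n] to be nilpotent for [n < 0] and [v_0^2] to be congruent to [u_1], hence [v_0] to be a
    unit, without any division by 2. Coefficients are removed one at a time because the nilradical
    of [R] need not be nilpotent, whereas a single [r] with [r^k = 0] makes the correcting operator
    nilpotent of order [k]. Homogeneity of [r] makes the ideal it generates two-sided, so that a
    congruence of pairs modulo [r] passes to inverses, powers and limits. Odd coefficients are
    square-zero; they can therefore be removed in any finite range of degrees, which brings the odd
    components of [Z] and [T] to the orders that triangularity requires. *)

Lemma laurentP (R : pzRingType) (f g : laurent R) :
  (forall n, lcoef f n = lcoef g n) -> f = g.
Proof.
case: f g => [f hf] [g hg] /= /funext efg; subst g.
by congr exist; exact: Prop_irrelevance.
Qed.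

HB.instance Definition _ (R : pzRingType) := gen_eqMixin (laurent R).
HB.instance Definition _ (R : pzRingType) := gen_choiceMixin (laurent R).

Section LaurentZmod.
Variable R : pzRingType.
Local Coercion lcoef : laurent >-> Funclass.
Implicit Types f g h : laurent R.

Definition lopp f : laurent R :=
  exist _ _ (@is_laurent_map R R (@GRing.opp R) f (oppr0 R)).

Fact laddA : associative (@ladd R).
Proof. by move=> f g h; apply: laurentP => n /=; rewrite addrA. Qed.
Fact laddC : commutative (@ladd R).
Proof. by move=> f g; apply: laurentP => n /=; rewrite addrC. Qed.
Fact ladd0 : left_id (lzero R) (@ladd R).
Proof. by move=> f; apply: laurentP => n /=; rewrite if_same add0r. Qed.
Fact laddN : left_inverse (lzero R) lopp (@ladd R).
Proof. by move=> f; apply: laurentP => n /=; rewrite if_same addNr. Qed.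

HB.instance Definition _ := GRing.isZmodule.Build (laurent R) laddA laddC ladd0 laddN.

Lemma lcoefD f g n : lcoef (f + g) n = f n + g n. Proof. by []. Qed.
Lemma lcoefN f n : lcoef (- f) n = - f n. Proof. by []. Qed.
Lemma lcoefB f g n : lcoef (f - g) n = f n - g n. Proof. by []. Qed.
Lemma lcoef0 n : lcoef (0 : laurent R) n = 0. Proof. exact: if_same. Qed.

Definition mono (r : R) (k : int) : laurent R := exist _ _ (is_laurent_const r k).

Lemma lcoef_mono r k n : mono r k n = if n == k then r else 0.
Proof. by []. Qed.

Lemma lcoef_mono_id r k : mono r k k = r.
Proof. by rewrite lcoef_mono eqxx. Qed.

Lemma monoD r s k : mono (r + s) k = mono r k + mono s k.
Proof.
by apply: laurentP => n; rewrite lcoefD !lcoef_mono; case: ifP; rewrite ?addr0.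
Qed.

Lemma mono0 k : mono 0 k = 0.
Proof. by apply: laurentP => n; rewrite lcoef0 lcoef_mono if_same. Qed.

Definition lfil (P : int) f := forall n, n < P -> f n = 0.

Lemma lfil0 P : lfil P 0. Proof. by move=> n _; rewrite lcoef0. Qed.
Lemma lfilD P f g : lfil P f -> lfil P g -> lfil P (f + g).
Proof. by move=> hf hg n hn; rewrite lcoefD hf ?hg ?addr0. Qed.
Lemma lfilN P f : lfil P f -> lfil P (- f).
Proof. by move=> hf n hn; rewrite lcoefN hf ?oppr0. Qed.
Lemma lfil_sep f : (forall P, lfil P f) -> f = 0.
Proof.
by move=> hf; apply: laurentP => n; rewrite lcoef0 (hf (n + 1)) // ltrDl.
Qed.
Lemma lfil_le P Q f : Q <= P -> lfil P f -> lfil Q f.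
Proof. by move=> le hf n hn; apply: hf; apply: lt_le_trans hn le. Qed.
Lemma lfil_bound f : lfil (lbound f) f.
Proof. exact: lboundP. Qed.
Lemma lfil_mono r k : lfil k (mono r k).
Proof. by move=> n hn; rewrite lcoef_mono lt_eqF. Qed.

Fact is_laurent_tail P f : is_laurent (fun n => if n < P then 0 else f n).
Proof. by exists (lbound f) => n hn; rewrite lboundP // if_same. Qed.
Definition ltail P f : laurent R := exist _ _ (is_laurent_tail P f).

Lemma lfil_tail P f : lfil P (ltail P f).
Proof. by move=> n hn /=; rewrite hn. Qed.

Lemma ltail_step P f : ltail P f = mono (f P) P + ltail (P + 1) f.
Proof.
apply: laurentP => n; rewrite lcoefD lcoef_mono /=.
have -> : (n < P + 1) = (n <= P) by rewrite ltzD1.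
by case: (ltgtP n P) => [|| ->]; rewrite ?addr0 ?add0r.
Qed.

Lemma ltail_id P f : lfil P f -> ltail P f = f.
Proof.
by move=> hf; apply: laurentP => n /=; case: ifP => // hn; rewrite hf.
Qed.

Lemma ltrunc l f k : lfil l f ->
  f = \sum_(i < k) mono (f (l + i%:Z)) (l + i%:Z) + ltail (l + k%:Z) f.
Proof.
move=> hf; elim: k => [|k IH]; first by rewrite big_ord0 add0r addr0 ltail_id.
by rewrite {1}IH big_ord_recr /= -addrA ltail_step -(addrA l) -PoszD addn1.
Qed.

Definition lcontV (V : zmodType) (fil : int -> V -> Prop) (F : laurent R -> V) :=
  (forall f g, F (f + g) = F f + F g) /\
  (forall P, exists N, forall f, lfil N f -> fil P (F f)).

(** Up to a tail of arbitrarily high order a Laurent series is a finite sum of monomials, and a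
    separated target cannot see such tails. The target is left general so that the statement also
    serves for maps into the superalgebra. *)
Lemma laurent_density (V : zmodType) (fil : int -> V -> Prop) (F G : laurent R -> V) :
  (forall P x y, fil P x -> fil P y -> fil P (x - y)) ->
  (forall x, (forall P, fil P x) -> x = 0) ->
  lcontV fil F -> lcontV fil G ->
  (forall r k, F (mono r k) = G (mono r k)) -> F =1 G.
Proof.
move=> filB sep [addF cF] [addG cG] FG f.
have F0 : F 0 = 0 by apply: (addIr (F 0)); rewrite -addF !add0r.
have G0 : G 0 = 0 by apply: (addIr (G 0)); rewrite -addG !add0r.
apply/eqP; rewrite -subr_eq0; apply/eqP; apply: sep => P.
have [[N1 h1] [N2 h2]] := (cF P, cG P).
set l := lbound f; set k := (absz (N1 - l)%R + absz (N2 - l)%R)%N.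
rewrite (ltrunc k (@lfil_bound f)) -/l addF addG.
have FE := big_morph F addF F0; have GE := big_morph G addG G0.
rewrite FE GE (eq_bigr (fun i : 'I_k => G (mono (f (l + i%:Z)) (l + i%:Z)))) //.
rewrite opprD addrACA subrr add0r; apply: filB.
- by apply: h1; apply: lfil_le (@lfil_tail _ _); rewrite /k; lia.
- by apply: h2; apply: lfil_le (@lfil_tail _ _); rewrite /k; lia.
Qed.

End LaurentZmod.

(** * Convolution product, ring structure and derivation *)

Section LaurentRing.
Variable R : pzRingType.
Local Coercion lcoef : laurent >-> Funclass.
Implicit Types f g h : laurent R.

Lemma window_widen (F : int -> R) (l0 l : int) (T K : nat) :
  l0 <= l -> l + K%:Z <= l0 + T%:Z ->
  (forall i, i < l -> F i = 0) -> (forall i, l + K%:Z <= i -> F i = 0) ->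
  \sum_(k < T) F (l0 + k%:Z) = \sum_(k < K) F (l + k%:Z).
Proof.
move=> le leT h1 h2; pose m := absz (l - l0)%R.
have -> : T = (m + K + (T - m - K))%N by rewrite /m; lia.
rewrite !big_split_ord /=.
rewrite [X in X + _ + _]big1 => [|i _]; last by apply: h1; have := ltn_ord i; lia.
rewrite [X in _ + X]big1 => [|i _]; last by apply: h2; rewrite /m; lia.
by rewrite add0r addr0; apply: eq_bigr => i _; congr F; rewrite /m; lia.
Qed.

Lemma window_eq (F : int -> R) (l1 l2 : int) (K1 K2 : nat) :
  (forall i, i < l1 -> F i = 0) -> (forall i, l1 + K1%:Z <= i -> F i = 0) ->
  (forall i, i < l2 -> F i = 0) -> (forall i, l2 + K2%:Z <= i -> F i = 0) ->
  \sum_(k < K1) F (l1 + k%:Z) = \sum_(k < K2) F (l2 + k%:Z).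
Proof.
move=> h1 h2 h3 h4; pose l0 := Order.min l1 l2.
pose T := (absz (l1 - l2)%R + K1 + K2)%N.
rewrite -(@window_widen F l0 l1 T) ?/l0 ?/T //; [|lia|lia].
by rewrite -(@window_widen F l0 l2 T) ?/l0 ?/T //; lia.
Qed.

(** The product is defined through the arbitrary bounds chosen by [lbound]. Any lower bounds and any
    sufficiently long window give the same value, so two products can be compared on a common
    window. *)
Lemma lmulE f g (a b n : int) (K : nat) :
  lfil a f -> lfil b g -> n - a - b < K%:Z ->
  lmul f g n = \sum_(k < K) f (a + k%:Z) * g (n - a - k%:Z).
Proof.
move=> hf hg hK; pose F i := f i * g (n - i).
have -> : \sum_(k < K) f (a + k%:Z) * g (n - a - k%:Z) = \sum_(k < K) F (a + k%:Z).
  by apply: eq_bigr => i _; rewrite /F; congr (_ * g _); lia.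
have Flo i : i < a -> F i = 0 by move=> hi; rewrite /F hf ?mul0r.
have Fhi i : a + K%:Z <= i -> F i = 0.
  by move=> hi; rewrite /F hg ?mulr0 //; lia.
rewrite /= /lmul_coef; set a0 := lbound f; set b0 := lbound g.
have F0lo i : i < a0 -> F i = 0 by move=> hi; rewrite /F lboundP ?mul0r.
case: ifP => [le|]; last first.
  move=> /negbT; rewrite -ltNge => lt; rewrite big1 // => i _.
  have [hi|hi] := ltP (a + i%:Z) a0; first exact: F0lo.
  by rewrite /F (@lboundP _ g) ?mulr0 // -/b0; lia.
rewrite (eq_bigr (fun k : 'I__ => F (a0 + k%:Z))) => [|i _].
  apply: window_eq => // i hi; rewrite /F (@lboundP _ g) ?mulr0 // -/b0; lia.
by rewrite /F; congr (_ * g _); lia.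
Qed.

(** The additively closed [J] will be zero, a parity component, the multiples of an element, or the
    ideal of elements with nilpotent even part. *)
Lemma lmul_in (J : R -> Prop) f g n : J 0 -> (forall x y, J x -> J y -> J (x + y)) ->
  (forall i, J (f i * g (n - i))) -> J (lmul f g n).
Proof.
move=> J0 JD Jfg; rewrite /= /lmul_coef; case: ifP => // _.
apply: (big_ind J) => // i _; move: (Jfg (lbound f + i%:Z)); congr (J (_ * g _)); lia.
Qed.

(** Isolates one term of the convolution modulo [J]. For [J] zero it computes products with
    monomials and lowest coefficients; for the nilpotent ideal it compares leading coefficients. *)
Lemma lmul_lead (J : R -> Prop) f g m n : J 0 -> (forall x y, J x -> J y -> J (x + y)) ->
  (forall i, i != m -> J (f i * g (n - i))) -> J (lmul f g n - f m * g (n - m)).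
Proof.
(* The window starts at or below [m], so that the distinguished index occurs in it even when it lies
   below [lbound f]. *)
move=> J0 JD Jfg; pose a := Order.min (lbound f) m.
pose K := (absz (n - a - lbound g)%R + absz (m - a)%R).+1.
have ha : lfil a f by apply: lfil_le (@lfil_bound _ f); rewrite /a; lia.
rewrite (@lmulE _ _ a (lbound g) n K) //; last first.
- by rewrite /K; lia.
- exact: lfil_bound.
have hm : (absz (m - a)%R < K)%N by rewrite /K; lia.
rewrite (bigD1 (Ordinal hm)) //=.
have -> : a + (absz (m - a)%R)%:Z = m by rewrite /a; lia.
have -> : n - a - (absz (m - a)%R)%:Z = n - m by rewrite /a; lia.
rewrite addrAC subrr add0r; apply: (big_ind J) => // i /negP hi.
have := Jfg (a + i%:Z); rewrite opprD addrA; apply; apply/eqP => e; apply: hi.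
by apply/eqP/val_inj => /=; lia.
Qed.

Lemma mono_mul r k g n : lmul (mono r k) g n = r * g (n - k).
Proof.
have := @lmul_lead (fun x => x = 0) (mono r k) g k n (erefl _).
rewrite lcoef_mono_id => /(_ _ _)/eqP; rewrite subr_eq0 => H.
apply/eqP/H => [x y -> ->|i /negbTE hi]; first by rewrite addr0.
by rewrite lcoef_mono hi mul0r.
Qed.

Lemma mul_mono f s k n : lmul f (mono s k) n = f (n - k) * s.
Proof.
have := @lmul_lead (fun x => x = 0) f (mono s k) (n - k) n (erefl _).
rewrite subKr lcoef_mono_id => /(_ _ _)/eqP; rewrite subr_eq0 => H.
apply/eqP/H => [x y -> ->|i hi]; first by rewrite addr0.
by rewrite lcoef_mono ifN ?mulr0 //; move: hi; lia.
Qed.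

Lemma lmul_fil P Q f g : lfil P f -> lfil Q g -> lfil (P + Q) (lmul f g).
Proof.
move=> hf hg n hn; apply: (@lmul_in (fun x => x = 0)) => //.
  by move=> x y -> ->; rewrite addr0.
move=> i; have [hi|hi] := ltP i P; first by rewrite hf ?mul0r.
by rewrite hg ?mulr0 //; lia.
Qed.

Fact lmulDl : left_distributive (@lmul R) +%R.
Proof.
move=> f g h; apply: laurentP => n; rewrite lcoefD.
pose a := Order.min (lbound f) (lbound g).
have ha : lfil a f by apply: lfil_le (@lfil_bound _ f); rewrite /a; lia.
have hb : lfil a g by apply: lfil_le (@lfil_bound _ g); rewrite /a; lia.
pose K := (absz (n - a - lbound h)%R).+1.
have hK : n - a - lbound h < K%:Z by rewrite /K; lia.
rewrite !(@lmulE _ h a (lbound h) n K) //; try exact: lfil_bound; try exact: lfilD.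
by rewrite -big_split; apply: eq_bigr => i _; rewrite lcoefD mulrDl.
Qed.

Fact lmulDr : right_distributive (@lmul R) +%R.
Proof.
move=> h f g; apply: laurentP => n; rewrite lcoefD.
pose a := Order.min (lbound f) (lbound g).
have ha : lfil a f by apply: lfil_le (@lfil_bound _ f); rewrite /a; lia.
have hb : lfil a g by apply: lfil_le (@lfil_bound _ g); rewrite /a; lia.
pose K := (absz (n - lbound h - a)%R).+1.
have hK : n - lbound h - a < K%:Z by rewrite /K; lia.
rewrite !(@lmulE h _ (lbound h) a n K) //; try exact: lfil_bound; try exact: lfilD.
by rewrite -big_split; apply: eq_bigr => i _; rewrite lcoefD mulrDr.
Qed.

Definition lcont (F : laurent R -> laurent R) := lcontV (@lfil R) F.

Lemma lcont_mull g : lcont (lmul g).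
Proof.
split=> [f f'|P]; first exact: lmulDr.
exists (P - lbound g) => f hf.
by apply: lfil_le (lmul_fil (@lfil_bound _ g) hf); lia.
Qed.

Lemma lcont_mulr g : lcont (fun f => lmul f g).
Proof.
split=> [f f'|P]; first exact: lmulDl.
exists (P - lbound g) => f hf.
by apply: lfil_le (lmul_fil hf (@lfil_bound _ g)); lia.
Qed.

Lemma lcont_comp F G : lcont F -> lcont G -> lcont (F \o G).
Proof.
move=> [FD Fc] [GD Gc]; split=> [f g|P] /=; first by rewrite GD FD.
have [N hN] := Fc P; have [M hM] := Gc N; exists M => f hf; exact/hN/hM.
Qed.

Lemma lcontD F G : lcont F -> lcont G -> lcont (fun f => F f + G f).
Proof.
move=> [FD Fc] [GD Gc]; split=> [f g|P] /=; first by rewrite FD GD addrACA.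
have [N hN] := Fc P; have [M hM] := Gc P; exists (Order.max N M) => f hf.
by apply: lfilD; [apply: hN | apply: hM]; apply: lfil_le hf; lia.
Qed.

Lemma lcont_ext F G : lcont F -> lcont G ->
  (forall r k, F (mono r k) = G (mono r k)) -> F =1 G.
Proof.
apply: laurent_density => [P x y hx hy|]; last exact: lfil_sep.
by apply: lfilD => //; apply: lfilN.
Qed.

Fact lmul_monoM (r s : R) k l : lmul (mono r k) (mono s l) = mono (r * s) (k + l).
Proof.
apply: laurentP => n; rewrite mono_mul !lcoef_mono.
have -> : (n - k == l) = (n == k + l) by lia.
by case: ifP => // _; rewrite mulr0.
Qed.

Fact lmulA : associative (@lmul R).
Proof.
move=> f g h; move: f; apply: lcont_ext.
- exact: lcont_mulr.
- by apply: (@lcont_comp (fun f => lmul f h)); exact: lcont_mulr.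
move=> r k; move: g; apply: lcont_ext.
- by apply: (@lcont_comp (lmul _) (fun f => lmul f h)); [exact: lcont_mull|exact: lcont_mulr].
- by apply: (@lcont_comp (fun f => lmul f h)); [exact: lcont_mulr|exact: lcont_mull].
move=> s l; move: h; apply: lcont_ext.
- by apply: (@lcont_comp (lmul _)); exact: lcont_mull.
- exact: lcont_mull.
by move=> t m; rewrite !lmul_monoM mulrA addrA.
Qed.

Fact lmul1l : left_id (lone R) (@lmul R).
Proof. by move=> f; apply: laurentP => n; rewrite mono_mul mul1r subr0. Qed.
Fact lmul1r : right_id (lone R) (@lmul R).
Proof. by move=> f; apply: laurentP => n; rewrite mul_mono mulr1 subr0. Qed.

HB.instance Definition _ :=
  GRing.Zmodule_isPzRing.Build (laurent R) lmulA lmul1l lmul1r lmulDl lmulDr.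

Lemma monoM (r s : R) k l : mono r k * mono s l = mono (r * s) (k + l).
Proof. exact: lmul_monoM. Qed.

Lemma lcoef_monoM r k g n : lcoef (mono r k * g) n = r * g (n - k).
Proof. exact: mono_mul. Qed.

Lemma lcoefM_in (J : R -> Prop) f g n : J 0 -> (forall x y, J x -> J y -> J (x + y)) ->
  (forall i, J (f i * g (n - i))) -> J (lcoef (f * g) n).
Proof. exact: lmul_in. Qed.

Lemma lcoefM_lead (J : R -> Prop) f g m n : J 0 -> (forall x y, J x -> J y -> J (x + y)) ->
  (forall i, i != m -> J (f i * g (n - i))) -> J (lcoef (f * g) n - f m * g (n - m)).
Proof. exact: lmul_lead. Qed.

Lemma lcoefM1 f g m n :
  (forall i, i != m -> f i * g (n - i) = 0) -> lcoef (f * g) n = f m * g (n - m).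
Proof.
move=> h; apply/eqP; rewrite -subr_eq0; apply/eqP.
apply: (@lcoefM_lead (fun x => x = 0)) => // x y -> ->; exact: addr0.
Qed.

(** Covers both commutation rules: [g = h] when [f] has even coefficients, and [g] the parity twist
    of [h] when they are odd. The second hypothesis transfers the lower bound of [g] to [h];
    reversing the window then exchanges the two convolutions. *)
Lemma lmul_swap f g h : (forall i j, f i * g j = h j * f i) ->
  (forall n, g n = 0 -> h n = 0) -> f * g = h * f.
Proof.
move=> fgh gh; apply: laurentP => n.
have hh : lfil (lbound g) h by move=> i hi; apply: gh; exact: lboundP.
pose K := (absz (n - lbound f - lbound g)%R).+1.
have [lt|le] := ltP n (lbound f + lbound g).
  rewrite (lmul_fil (@lfil_bound _ f) (@lfil_bound _ g)) //.
  by rewrite (lmul_fil hh (@lfil_bound _ f)) // addrC.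
rewrite (@lmulE f g (lbound f) (lbound g) n K) /K; try exact: lfil_bound; last lia.
rewrite (@lmulE h f (lbound g) (lbound f) n K) /K //; try exact: lfil_bound; last lia.
rewrite (reindex_inj rev_ord_inj) /=; apply: eq_bigr => i _.
by rewrite fgh; congr (h _ * f _); have := ltn_ord i; lia.
Qed.

Lemma lderD f g : lder (f + g) = lder f + lder g.
Proof. by apply: laurentP => n /=; rewrite mulrzDl. Qed.

Lemma lcont_der : lcont (@lder R).
Proof.
split=> [|P]; first exact: lderD.
exists (P + 1) => f hf n hn /=; rewrite hf ?mul0rz //; lia.
Qed.

Lemma lder_mono (r : R) k : lder (mono r k) = mono (r *~ k) (k - 1).
Proof.
apply: laurentP => n /=; have -> : (n + 1 == k) = (n == k - 1) by lia.
by case: eqP => [->|]; rewrite ?mul0rz // subrK.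
Qed.

Lemma lder0 : lder (0 : laurent R) = 0.
Proof. by rewrite -(mono0 R 0) lder_mono mul0rz !mono0. Qed.

Lemma lderM f g : lder (f * g) = lder f * g + f * lder g.
Proof.
move: f; apply: lcont_ext.
- by apply: (@lcont_comp (@lder R)); [exact: lcont_der|exact: lcont_mulr].
- apply: lcontD; last exact: lcont_mulr.
  by apply: (@lcont_comp (fun f => f * g)); [exact: lcont_mulr|exact: lcont_der].
move=> r k; move: g; apply: lcont_ext.
- by apply: (@lcont_comp (@lder R)); [exact: lcont_der|exact: lcont_mull].
- apply: lcontD; first exact: lcont_mull.
  by apply: (@lcont_comp (lmul (mono r k))); [exact: lcont_mull|exact: lcont_der].
move=> s l; rewrite !lder_mono !monoM lder_mono.
have -> : k - 1 + l = k + l - 1 by lia.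
have -> : k + (l - 1) = k + l - 1 by lia.
by rewrite -monoD mulrzAl mulrzAr -mulrzDr.
Qed.

End LaurentRing.

(** * The superalgebra of Laurent series *)

Section Parity.
Variables (R : pzRingType) (ev od : {additive R -> R}) (HR : superring ev od).
Implicit Types x y : R.

Lemma even_od0 x : is_even ev x -> od x = 0.
Proof. by move=> <-; rewrite (sr_odev HR). Qed.
Lemma odd_ev0 x : is_odd od x -> ev x = 0.
Proof. by move=> <-; rewrite (sr_evod HR). Qed.
Lemma od0_even x : od x = 0 -> is_even ev x.
Proof. by move=> h; rewrite /is_even -{2}(sr_decomp HR x) h addr0. Qed.
Lemma ev0_odd x : ev x = 0 -> is_odd od x.
Proof. by move=> h; rewrite /is_odd -{2}(sr_decomp HR x) h add0r. Qed.
Lemma ev_even x : is_even ev (ev x). Proof. exact: sr_evev HR x. Qed.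
Lemma od_odd x : is_odd od (od x). Proof. exact: sr_odod HR x. Qed.

Lemma even0 : is_even ev 0. Proof. exact: raddf0. Qed.
Lemma odd0 : is_odd od 0. Proof. exact: raddf0. Qed.
Lemma even1 : is_even ev 1. Proof. exact: sr_ev1 HR. Qed.
Lemma evenD x y : is_even ev x -> is_even ev y -> is_even ev (x + y).
Proof. by rewrite /is_even raddfD => -> ->. Qed.
Lemma oddD x y : is_odd od x -> is_odd od y -> is_odd od (x + y).
Proof. by rewrite /is_odd raddfD => -> ->. Qed.
Lemma evenN x : is_even ev x -> is_even ev (- x).
Proof. by rewrite /is_even raddfN => ->. Qed.
Lemma oddN x : is_odd od x -> is_odd od (- x).
Proof. by rewrite /is_odd raddfN => ->. Qed.
Lemma evenMz x k : is_even ev x -> is_even ev (x *~ k).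
Proof. by rewrite /is_even raddfMz => ->. Qed.
Lemma oddMz x k : is_odd od x -> is_odd od (x *~ k).
Proof. by rewrite /is_odd raddfMz => ->. Qed.
Lemma even_mul x y : is_even ev x -> is_even ev y -> is_even ev (x * y).
Proof. by move=> <- <-; apply: od0_even; rewrite (sr_mul_ee HR). Qed.
Lemma odd_mul x y : is_odd od x -> is_odd od y -> is_even ev (x * y).
Proof. by move=> <- <-; apply: od0_even; rewrite (sr_mul_oo HR). Qed.
Lemma even_odd_mul x y : is_even ev x -> is_odd od y -> is_odd od (x * y).
Proof. by move=> <- <-; apply: ev0_odd; rewrite (sr_mul_eo HR). Qed.
Lemma odd_even_mul x y : is_odd od x -> is_even ev y -> is_odd od (x * y).
Proof. by move=> <- <-; apply: ev0_odd; rewrite (sr_mul_oe HR). Qed.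
Lemma even_exp x k : is_even ev x -> is_even ev (x ^+ k).
Proof.
by move=> h; elim: k => [|k IH]; rewrite ?exprS; [exact: even1 | exact: even_mul].
Qed.

Lemma even_commr x y : is_even ev x -> x * y = y * x.
Proof. by move=> <-; exact: sr_even_central HR x y. Qed.

Lemma sparD : {morph spar ev od : x y / x + y}.
Proof. by move=> x y; rewrite /spar !raddfD /= addrACA. Qed.
Lemma spar_even x : is_even ev x -> spar ev od x = x.
Proof. by move=> h; rewrite /spar even_od0 // subr0. Qed.
Lemma spar_odd x : is_odd od x -> spar ev od x = - x.
Proof. by move=> h; rewrite /spar odd_ev0 // h sub0r. Qed.
Lemma sparK : involutive (spar ev od).
Proof.
move=> x; rewrite [in LHS](_ : spar ev od x = ev x + - od x) // sparD.
rewrite (spar_even (ev_even x)) (spar_odd (oddN (od_odd x))) opprK.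
exact: sr_decomp HR x.
Qed.

Lemma evM x y : ev (x * y) = ev x * ev y + od x * od y.
Proof.
rewrite -{1}(sr_decomp HR x) -{1}(sr_decomp HR y) mulrDl !mulrDr !raddfD /=.
rewrite (sr_mul_eo HR) (sr_mul_oe HR) addr0 add0r.
by congr (_ + _); [apply: even_mul; exact: ev_even | apply: odd_mul; exact: od_odd].
Qed.

Lemma odM x y : od (x * y) = ev x * od y + od x * ev y.
Proof.
rewrite -{1}(sr_decomp HR x) -{1}(sr_decomp HR y) mulrDl !mulrDr !raddfD /=.
rewrite (sr_mul_ee HR) (sr_mul_oo HR) addr0 add0r.
by congr (_ + _); [apply: even_odd_mul | apply: odd_even_mul];
  by [exact: ev_even | exact: od_odd].
Qed.

Lemma sparM : {morph spar ev od : x y / x * y}.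
Proof.
move=> x y; rewrite /spar evM odM mulrBl !mulrBr opprD opprB !addrA.
by rewrite (addrAC (ev x * ev y)) -!addrA; congr (_ + _); rewrite addrCA addrA [RHS]addrC.
Qed.

Lemma odd_mul_spar x y : is_odd od x -> x * spar ev od y = y * x.
Proof.
move=> hx; rewrite /spar -{3}(sr_decomp HR y) mulrBr mulrDl; congr (_ + _).
  by rewrite (even_commr _ (ev_even y)).
by rewrite -hx (sr_odd_anticomm HR) opprK.
Qed.

Lemma odd_sqr x : is_odd od x -> x * x = 0.
Proof. by move=> <-; exact: sr_odd_sq HR x. Qed.

End Parity.

(** * Parity twist and sign rules for Laurent series *)

Section LaurentParity.
Variables (R : pzRingType) (ev od : {additive R -> R}) (HR : superring ev od).
Local Coercion lcoef : laurent >-> Funclass.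
Local Notation sg := (lsig ev od).
Implicit Types f g h : laurent R.

Definition leven f := forall n, is_even ev (f n).
Definition lodd f := forall n, is_odd od (f n).

Lemma lsigD : {morph sg : f g / f + g}.
Proof. by move=> f g; apply: laurentP => n; exact: sparD. Qed.
Lemma lsig0 : sg 0 = 0.
Proof. by apply: laurentP => n; rewrite lcoef0 /= if_same spar0. Qed.
Lemma lsigK : involutive sg.
Proof. by move=> f; apply: laurentP => n; exact: sparK. Qed.
Lemma lsig_even f : leven f -> sg f = f.
Proof. by move=> h; apply: laurentP => n; exact: spar_even. Qed.
Lemma lsig_odd f : lodd f -> sg f = - f.
Proof. by move=> h; apply: laurentP => n; exact: spar_odd. Qed.
Lemma lsig_mono r k : sg (mono r k) = mono (spar ev od r) k.
Proof.
by apply: laurentP => n; rewrite lcoef_mono /=; case: eqP => // _; rewrite spar0.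
Qed.
Lemma lfil_sig P f : lfil P f -> lfil P (sg f).
Proof. by move=> h n hn /=; rewrite h ?spar0. Qed.
Lemma lcont_sig : lcont sg.
Proof. by split; [exact: lsigD | move=> P; exists P => f; exact: lfil_sig]. Qed.
Lemma lsigM : {morph sg : f g / f * g}.
Proof.
move=> f g; move: f; apply: lcont_ext.
- by apply: (@lcont_comp _ sg); [exact: lcont_sig|exact: lcont_mulr].
- by apply: (@lcont_comp _ (fun f => f * _)); [exact: lcont_mulr|exact: lcont_sig].
move=> r k; move: g; apply: lcont_ext.
- by apply: (@lcont_comp _ sg); [exact: lcont_sig|exact: lcont_mull].
- by apply: (@lcont_comp _ (lmul _)); [exact: lcont_mull|exact: lcont_sig].
by move=> s l; rewrite !(monoM, lsig_mono) sparM.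
Qed.
Lemma leven0 : leven 0. Proof. by move=> n; rewrite lcoef0; exact: even0. Qed.
Lemma lodd0 : lodd 0. Proof. by move=> n; rewrite lcoef0; exact: odd0. Qed.
Lemma leven_mono r k : is_even ev r -> leven (mono r k).
Proof. by move=> h n; rewrite lcoef_mono; case: ifP => // _; exact: even0. Qed.
Lemma lodd_mono r k : is_odd od r -> lodd (mono r k).
Proof. by move=> h n; rewrite lcoef_mono; case: ifP => // _; exact: odd0. Qed.
Lemma levenD f g : leven f -> leven g -> leven (f + g).
Proof. by move=> hf hg n; exact: evenD. Qed.
Lemma loddD f g : lodd f -> lodd g -> lodd (f + g).
Proof. by move=> hf hg n; exact: oddD. Qed.
Lemma levenN f : leven f -> leven (- f).
Proof. by move=> hf n; exact: evenN. Qed.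
Lemma loddN f : lodd f -> lodd (- f).
Proof. by move=> hf n; exact: oddN. Qed.
Lemma leven_sig f : leven f -> leven (sg f).
Proof. by move=> h; rewrite lsig_even. Qed.
Lemma lodd_sig f : lodd f -> lodd (sg f).
Proof. by move=> h; rewrite lsig_odd //; exact: loddN. Qed.
Lemma leven_der f : leven f -> leven (lder f).
Proof. by move=> h n; exact: evenMz. Qed.
Lemma lodd_der f : lodd f -> lodd (lder f).
Proof. by move=> h n; exact: oddMz. Qed.
Lemma leven_mul f g : leven f -> leven g -> leven (f * g).
Proof.
move=> hf hg n; apply: (@lmul_in _ (is_even ev)) => [|x y|i]; first exact: even0.
- exact: evenD.
- exact: (even_mul HR).
Qed.
Lemma lodd_mul f g : lodd f -> lodd g -> leven (f * g).
Proof.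
move=> hf hg n; apply: (@lmul_in _ (is_even ev)) => [|x y|i]; first exact: even0.
- exact: evenD.
- exact: (odd_mul HR).
Qed.
Lemma leven_odd_mul f g : leven f -> lodd g -> lodd (f * g).
Proof.
move=> hf hg n; apply: (@lmul_in _ (is_odd od)) => [|x y|i]; first exact: odd0.
- exact: oddD.
- exact: (even_odd_mul HR).
Qed.
Lemma lodd_even_mul f g : lodd f -> leven g -> lodd (f * g).
Proof.
move=> hf hg n; apply: (@lmul_in _ (is_odd od)) => [|x y|i]; first exact: odd0.
- exact: oddD.
- exact: (odd_even_mul HR).
Qed.

Lemma leven_comm f g : leven f -> f * g = g * f.
Proof. by move=> hf; apply: lmul_swap => // i j; exact: (even_commr HR). Qed.
Lemma lodd_comm_sig f g : lodd f -> f * sg g = g * f.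
Proof.
move=> hf; apply: lmul_swap => [i j|n] /=; first exact: (odd_mul_spar HR).
by move=> h; rewrite -[_ n](sparK HR) h spar0.
Qed.
Lemma lodd_anticomm f g : lodd f -> lodd g -> f * g = - (g * f).
Proof. by move=> hf hg; rewrite -(lodd_comm_sig g hf) lsig_odd // mulrN opprK. Qed.

(* The lowest coefficient can be removed without changing the square, so the
   square vanishes to every order. *)
Lemma lodd_sqr f : lodd f -> f * f = 0.
Proof.
move=> hf; have tl k : exists2 g, lfil (lbound f + k%:Z) g & lodd g /\ f * f = g * g.
  elim: k => [|k [g hg [go ->]]]; first by exists f => //; rewrite addr0; exact: lfil_bound.
  set l := lbound f + _ in hg; exists (ltail (l + 1) g).
    by rewrite intS addrCA addrC; exact: lfil_tail.
  have to : lodd (ltail (l + 1) g) by move=> n /=; case: ifP => // _; exact: odd0.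
  split=> //; rewrite -{1 2}(ltail_id hg) ltail_step mulrDl !mulrDr.
  have mo := lodd_mono l (go l).
  by rewrite (lodd_anticomm mo to) monoM (odd_sqr HR (go l)) mono0 add0r addrA addNr add0r.
apply: lfil_sep => P; have [g hg [_ ->]] := tl (absz (P - lbound f)%R + absz P)%N.
by apply: lfil_le (lmul_fil hg hg); lia.
Qed.

End LaurentParity.

(** An alias of [LS R] that mentions [HR]: the product depends on the parity projections and its
    associativity on the superring axioms, so the ring instance must find them in the type. *)
Definition superL (R : pzRingType) (ev od : {additive R -> R}) (HR : superring ev od) :=
  LS R.

(** * Ring structure, filtration and parity of the superalgebra *)

Section SuperRing.
Variables (R : pzRingType) (ev od : {additive R -> R}) (HR : superring ev od).
Local Coercion lcoef : laurent >-> Funclass.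
Local Notation sg := (lsig ev od).
Local Notation A := (superL HR).
Implicit Types (f g h : laurent R) (x y z w : A).

HB.instance Definition _ := GRing.Zmodule.copy A (laurent R * laurent R)%type.

Definition smul (x y : A) : A := ls_mul ev od x y.

Lemma smulE x y : smul x y = (x.1 * y.1, x.1 * y.2 + x.2 * sg y.1).
Proof. by []. Qed.

Fact smulA : associative smul.
Proof.
move=> [f1 g1] [f2 g2] [f3 g3]; rewrite !smulE /= lsigM // mulrA; congr pair.
by rewrite mulrDr mulrDl !mulrA addrA.
Qed.
Fact smul1l : left_id (ls_one R) smul.
Proof. by move=> [f g]; rewrite smulE /= !mul1r mul0r addr0. Qed.
Fact smul1r : right_id (ls_one R) smul.
Proof.
move=> [f g]; rewrite smulE /= mulr1 mulr0 add0r lsig_mono spar_even ?mulr1 //.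
exact: (even1 HR).
Qed.
Fact smulDl : left_distributive smul +%R.
Proof.
move=> x y w; have E : (x + y).2 * sg w.1 = x.2 * sg w.1 + y.2 * sg w.1 by exact: mulrDl.
rewrite !smulE E [_ * w.1]mulrDl [_ * w.2]mulrDl; congr pair.
exact: addrACA.
Qed.
Fact smulDr : right_distributive smul +%R.
Proof.
move=> x y w; have E : sg (y + w).1 = sg y.1 + sg w.1 by exact: lsigD.
rewrite !smulE E !mulrDr; congr pair.
exact: addrACA.
Qed.

HB.instance Definition _ :=
  GRing.Zmodule_isPzRing.Build A smulA smul1l smul1r smulDl smulDr.

Lemma superL_eq x y : x.1 = y.1 -> x.2 = y.2 -> x = y.
Proof. by case: x y => [f g] [f' g'] /= -> ->. Qed.

Lemma fstM x y : (x * y).1 = x.1 * y.1. Proof. by []. Qed.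
Lemma sndM x y : (x * y).2 = x.1 * y.2 + x.2 * sg y.1. Proof. by []. Qed.
Lemma fstD x y : (x + y).1 = x.1 + y.1. Proof. by []. Qed.
Lemma sndD x y : (x + y).2 = x.2 + y.2. Proof. by []. Qed.
Lemma fstX x n : (x ^+ n).1 = x.1 ^+ n.
Proof. by elim: n => // n IH; rewrite !exprS fstM IH. Qed.

Definition afil (P : int) (x : A) := lfil P x.1 /\ lfil P x.2.

Lemma afilE P x : afil P x <-> in_zM P x.
Proof.
split=> [[h1 h2] n hn|h]; first by split; [exact: h1|exact: h2].
by split=> n /h[].
Qed.

Lemma afil0 P : afil P 0. Proof. by split; exact: lfil0. Qed.
Lemma afilD P x y : afil P x -> afil P y -> afil P (x + y).
Proof. by move=> [? ?] [? ?]; split; exact: lfilD. Qed.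
Lemma afilN P x : afil P x -> afil P (- x).
Proof. by move=> [? ?]; split; exact: lfilN. Qed.
Lemma afilB P x y : afil P x -> afil P y -> afil P (x - y).
Proof. by move=> hx hy; apply: afilD => //; exact: afilN. Qed.
Lemma afil_sum (I : Type) (r : seq I) (Q : pred I) (F : I -> A) P :
  (forall i, Q i -> afil P (F i)) -> afil P (\sum_(i <- r | Q i) F i).
Proof. by move=> h; apply: big_ind => //; [exact: afil0|exact: afilD]. Qed.
Lemma afilMn P x n : afil P x -> afil P (x *+ n).
Proof. by move=> h; elim: n => [|n IH]; rewrite ?mulrS; [exact: afil0|exact: afilD]. Qed.
Lemma afil_sep x : (forall P, afil P x) -> x = 0.
Proof. by move=> h; apply: superL_eq; apply: lfil_sep => P; case: (h P). Qed.
Lemma afil_le P Q x : Q <= P -> afil P x -> afil Q x.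
Proof. by move=> le [? ?]; split; apply: lfil_le le _. Qed.
Lemma afil_bound x : exists b, afil b x.
Proof.
exists (Order.min (lbound x.1) (lbound x.2)).
by split; apply: lfil_le (@lfil_bound _ _); lia.
Qed.
Lemma afilM P Q x y : afil P x -> afil Q y -> afil (P + Q) (x * y).
Proof.
move=> [hx1 hx2] [hy1 hy2]; split; first exact: lmul_fil.
by apply: lfilD; apply: lmul_fil => //; exact: lfil_sig.
Qed.
Lemma afil1 : afil 0 1.
Proof. by split; [exact: (@lfil_mono R 1 0)|exact: lfil0]. Qed.
Lemma afilX P x n : afil P x -> afil (P * n%:Z) (x ^+ n).
Proof.
move=> h; elim: n => [|n IH]; first by rewrite mulr0; exact: afil1.
by rewrite exprS intS mulrDr mulr1; exact: afilM.
Qed.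

Definition m0 (r : R) k : A := (mono r k, 0).
Definition m1 (r : R) k : A := (0, mono r k).

Lemma m0M r s k l : m0 r k * m0 s l = m0 (r * s) (k + l).
Proof. by apply: superL_eq; rewrite ?fstM ?sndM /= ?(mulr0, mul0r, addr0) // monoM. Qed.
Lemma m0M1 r s k l : m0 r k * m1 s l = m1 (r * s) (k + l).
Proof.
by apply: superL_eq; rewrite ?fstM ?sndM /= ?mulr0 // monoM mul0r addr0.
Qed.
Lemma m1M0 r s k l : m1 r k * m0 s l = m1 (r * spar ev od s) (k + l).
Proof.
by apply: superL_eq; rewrite ?fstM ?sndM /= ?mul0r // lsig_mono monoM add0r.
Qed.
Lemma m1M r s k l : m1 r k * m1 s l = 0.
Proof. by apply: superL_eq; rewrite ?fstM ?sndM /= ?mul0r // lsig0 mulr0 addr0. Qed.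
Lemma m0_1 : m0 1 0 = 1. Proof. by []. Qed.
Lemma m0D r s k : m0 (r + s) k = m0 r k + m0 s k.
Proof. by apply: superL_eq; rewrite ?fstD ?sndD /= ?monoD ?addr0. Qed.
Lemma m0_0 k : m0 0 k = 0. Proof. by rewrite /m0 mono0. Qed.
Lemma m1_0 k : m1 0 k = 0. Proof. by rewrite /m1 mono0. Qed.
Lemma m0X r k n : m0 r k ^+ n = m0 (r ^+ n) (k * n%:Z).
Proof.
elim: n => [|n IH]; first by rewrite !expr0 mulr0.
by rewrite !exprS IH m0M intS mulrDr mulr1.
Qed.
Lemma afil_m0 r k : afil k (m0 r k).
Proof. by split; [exact: lfil_mono|exact: lfil0]. Qed.
Lemma afil_m1 r k : afil k (m1 r k).
Proof. by split; [exact: lfil0|exact: lfil_mono]. Qed.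

(** Scalars become left multiplications by constants, so that linearity over [R] can be expressed
    inside the ring. *)
Lemma m0_scale r x : m0 r 0 * x = ls_scale r x.
Proof.
apply: superL_eq; apply: laurentP => n.
  by rewrite fstM lcoef_monoM subr0.
by rewrite sndM mul0r addr0 lcoef_monoM subr0.
Qed.

Definition acont (F : A -> A) :=
  (forall x y, F (x + y) = F x + F y) /\
  (forall P, exists N, forall x, afil N x -> afil P (F x)).

Lemma acont_ext F G : acont F -> acont G ->
  (forall r k, F (m0 r k) = G (m0 r k)) -> (forall r k, F (m1 r k) = G (m1 r k)) ->
  F =1 G.
Proof.
move=> [FD Fc] [GD Gc] e0 e1 [f g].
have -> : (f, g) = (f, 0) + (0, g) :> A.
  by apply: superL_eq; rewrite ?fstD ?sndD /= ?addr0 ?add0r.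
rewrite FD GD; congr (_ + _).
- apply: (@laurent_density _ A afil (fun f => F (f, 0)) (fun f => G (f, 0))) => //.
  + exact: afilB.
  + exact: afil_sep.
  + split=> [f1 f2|P]; first by rewrite -FD; congr F; apply: superL_eq; rewrite // sndD addr0.
    by have [N hN] := Fc P; exists N => f1 hf; apply: hN; split => //; exact: lfil0.
  + split=> [f1 f2|P]; first by rewrite -GD; congr G; apply: superL_eq; rewrite // sndD addr0.
    by have [N hN] := Gc P; exists N => f1 hf; apply: hN; split => //; exact: lfil0.
- apply: (@laurent_density _ A afil (fun f => F (0, f)) (fun f => G (0, f))) => //.
  + exact: afilB.
  + exact: afil_sep.
  + split=> [f1 f2|P]; first by rewrite -FD; congr F; apply: superL_eq; rewrite // fstD addr0.
    by have [N hN] := Fc P; exists N => f1 hf; apply: hN; split => //; exact: lfil0.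
  + split=> [f1 f2|P]; first by rewrite -GD; congr G; apply: superL_eq; rewrite // fstD addr0.
    by have [N hN] := Gc P; exists N => f1 hf; apply: hN; split => //; exact: lfil0.
Qed.

Lemma acont_mull y : acont (fun x => y * x).
Proof.
split=> [x x'|P]; first exact: mulrDr.
have [b hb] := afil_bound y; exists (P - b) => x hx.
by apply: afil_le (afilM hb hx); lia.
Qed.
Lemma acont_mulr y : acont (fun x => x * y).
Proof.
split=> [x x'|P]; first exact: mulrDl.
have [b hb] := afil_bound y; exists (P - b) => x hx.
by apply: afil_le (afilM hx hb); lia.
Qed.
Lemma acont_comp F G : acont F -> acont G -> acont (F \o G).
Proof.
move=> [FD Fc] [GD Gc]; split=> [f g|P] /=; first by rewrite GD FD.
by have [N hN] := Fc P; have [M hM] := Gc N; exists M => f hf; exact/hN/hM.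
Qed.
Lemma acontD F G : acont F -> acont G -> acont (fun x => F x + G x).
Proof.
move=> [FD Fc] [GD Gc]; split=> [f g|P] /=; first by rewrite FD GD addrACA.
have [N hN] := Fc P; have [M hM] := Gc P; exists (Order.max N M) => f hf.
by apply: afilD; [apply: hN | apply: hM]; apply: afil_le hf; lia.
Qed.
Lemma acont_id : acont id.
Proof. by split=> // P; exists P. Qed.
Lemma acont0 F : acont F -> F 0 = 0.
Proof. by move=> [FD _]; apply: (addIr (F 0)); rewrite -FD !add0r. Qed.
Lemma acontN F x : acont F -> F (- x) = - F x.
Proof. by move=> hF; apply: (addIr (F x)); rewrite -hF.1 !addNr acont0. Qed.
Lemma acontB F x y : acont F -> F (x - y) = F x - F y.
Proof. by move=> hF; rewrite hF.1 acontN. Qed.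

Definition aeven (x : A) := leven ev x.1 /\ lodd od x.2.
Definition aodd (x : A) := lodd od x.1 /\ leven ev x.2.

Lemma aeven_comm x y : aeven x -> x * y = y * x.
Proof.
move=> [h1 h2]; apply: superL_eq; rewrite ?fstM ?sndM.
  by rewrite (leven_comm HR).
by rewrite (leven_comm HR y.2 h1) (lodd_comm_sig HR _ h2) lsig_even // addrC.
Qed.
Lemma aodd_sqr x : aodd x -> x * x = 0.
Proof.
move=> [h1 h2]; apply: superL_eq; rewrite ?fstM ?sndM; first by rewrite (lodd_sqr HR).
by rewrite (lsig_odd HR h1) mulrN (leven_comm HR x.1 h2) subrr.
Qed.
Lemma aodd_m0 x r : aodd x -> x * m0 r 0 = m0 (spar ev od r) 0 * x.
Proof.
move=> [h1 h2]; apply: superL_eq; rewrite ?fstM ?sndM /=.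
  by rewrite -lsig_mono -(lodd_comm_sig HR _ h1) lsigK.
by rewrite mulr0 add0r mul0r addr0 lsig_mono (leven_comm HR _ h2).
Qed.

Lemma aeven0 : aeven 0. Proof. by split; [exact: leven0|exact: lodd0]. Qed.
Lemma aodd0 : aodd 0. Proof. by split; [exact: lodd0|exact: leven0]. Qed.
Lemma aeven1 : aeven 1.
Proof. by split; [apply: (@leven_mono _ _ 1 0); exact: even1 HR|exact: lodd0]. Qed.
Lemma aevenD x y : aeven x -> aeven y -> aeven (x + y).
Proof. by move=> [? ?] [? ?]; split; [exact: levenD|exact: loddD]. Qed.
Lemma aoddD x y : aodd x -> aodd y -> aodd (x + y).
Proof. by move=> [? ?] [? ?]; split; [exact: loddD|exact: levenD]. Qed.
Lemma aevenN x : aeven x -> aeven (- x).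
Proof. by move=> [? ?]; split; [exact: levenN|exact: loddN]. Qed.
Lemma aoddN x : aodd x -> aodd (- x).
Proof. by move=> [? ?]; split; [exact: loddN|exact: levenN]. Qed.
Lemma aevenM x y : aeven x -> aeven y -> aeven (x * y).
Proof.
move=> [? ?] [? ?]; split; first exact: (leven_mul HR).
by apply: loddD; [exact: (leven_odd_mul HR)|apply: (lodd_even_mul HR) => //; exact: (leven_sig HR)].
Qed.
Lemma aoddM x y : aodd x -> aodd y -> aeven (x * y).
Proof.
move=> [? ?] [? ?]; split; first exact: (lodd_mul HR).
by apply: loddD; [exact: (lodd_even_mul HR)|apply: (leven_odd_mul HR) => //; exact: (lodd_sig HR)].
Qed.
Lemma aeven_oddM x y : aeven x -> aodd y -> aodd (x * y).
Proof.
move=> [? ?] [? ?]; split; first exact: (leven_odd_mul HR).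
by apply: levenD; [exact: (leven_mul HR)|apply: (lodd_mul HR) => //; exact: (lodd_sig HR)].
Qed.
Lemma aodd_evenM x y : aodd x -> aeven y -> aodd (x * y).
Proof. by move=> hx hy; rewrite -aeven_comm //; exact: aeven_oddM. Qed.
Lemma aevenX x n : aeven x -> aeven (x ^+ n).
Proof.
by move=> h; elim: n => [|n IH]; rewrite ?exprS; [exact: aeven1|exact: aevenM].
Qed.
Lemma aeven_m0 r k : is_even ev r -> aeven (m0 r k).
Proof. by split; [exact: leven_mono|exact: lodd0]. Qed.
Lemma aodd_m0_odd r k : is_odd od r -> aodd (m0 r k).
Proof. by split; [exact: lodd_mono|exact: leven0]. Qed.
Lemma aodd_m1 r k : is_even ev r -> aodd (m1 r k).
Proof. by split; [exact: lodd0|exact: leven_mono]. Qed.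
Lemma aeven_m1 r k : is_odd od r -> aeven (m1 r k).
Proof. by split; [exact: leven0|exact: lodd_mono]. Qed.

End SuperRing.

(** * Topologically nilpotent elements *)

Lemma laurent_complete (R : pzRingType) (s : nat -> laurent R) :
  (forall P, exists N, forall n, (N <= n)%N -> lfil P (s n.+1 - s n)) ->
  exists l, forall P, exists N, forall n, (N <= n)%N -> lfil P (s n - l).
Proof.
move=> /choice[N hN].
have stab P n m : n < P -> (N P <= m)%N -> lcoef (s m) n = lcoef (s (N P)) n.
  move=> hn /subnK <-; elim: (m - N P)%N => // k IH.
  by rewrite -IH addSn; apply/eqP; rewrite -subr_eq0 -lcoefB (hN P) // leq_addl.
(* Level [n + 1] is needed because level [P] controls only the degrees strictly below [P]. *)
pose c n := lcoef (s (N (n + 1))) n.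
have cE P n m : n < P -> (N P <= m)%N -> lcoef (s m) n = c n.
  move=> hn hm; pose M := maxn m (N (n + 1)).
  rewrite (stab P n m) // -(stab P n M) ?(stab (n + 1) n M) //; rewrite /M; lia.
have lc : is_laurent c.
  (* From stage [N 0] on all coefficients of negative degree are final, so a single term of the
     sequence bounds the order of the limit. *)
  exists (Order.min 0 (lbound (s (N 0)))) => n hn.
  by rewrite -(cE 0 n (N 0)) ?lboundP //; lia.
exists (exist _ c lc) => P; exists (N P) => m hm n hn.
by rewrite lcoefB /= (cE P) // subrr.
Qed.

Section Topology.
Variables (R : pzRingType) (ev od : {additive R -> R}) (HR : superring ev od).
Local Coercion lcoef : laurent >-> Funclass.
Local Notation A := (superL HR).
Implicit Types (x y z w l : A) (s t : nat -> A).

Definition acvg s l := forall P, exists N, forall n, (N <= n)%N -> afil P (s n - l).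

Lemma acvg_coef s l n : acvg s l -> exists N, forall m, (N <= m)%N ->
  (s m).1 n = l.1 n /\ (s m).2 n = l.2 n.
Proof.
move=> /(_ (n + 1))[N hN]; exists N => m /hN[h1 h2].
by split; apply/eqP; rewrite -subr_eq0 -lcoefB; apply/eqP; [apply: h1|apply: h2]; lia.
Qed.

(** Each coefficient of the limit is already a coefficient of some term, so conditions imposed
    coefficientwise pass to limits. *)
Lemma acvg_coef_in (J1 J2 : R -> Prop) s l : acvg s l ->
  (forall m n, J1 ((s m).1 n) /\ J2 ((s m).2 n)) -> forall n, J1 (l.1 n) /\ J2 (l.2 n).
Proof.
by move=> sl hs n; have [N /(_ N (leqnn N))[<- <-]] := acvg_coef n sl.
Qed.

Lemma acvg_fil P s l : acvg s l -> (forall n, afil P (s n)) -> afil P l.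
Proof.
move=> sl hs; have [N /(_ N (leqnn N)) h] := sl P.
by rewrite -[l](subKr (s N)); exact: afilB.
Qed.

Lemma acvg_even s l : acvg s l -> (forall n, aeven (s n)) -> aeven l.
Proof.
move=> sl hs; have h := @acvg_coef_in (is_even ev) (is_odd od) _ _ sl.
by split=> n; have [] := h (fun m n => conj ((hs m).1 n) ((hs m).2 n)) n.
Qed.

Lemma acvg_odd s l : acvg s l -> (forall n, aodd (s n)) -> aodd l.
Proof.
move=> sl hs; have h := @acvg_coef_in (is_odd od) (is_even ev) _ _ sl.
by split=> n; have [] := h (fun m n => conj ((hs m).1 n) ((hs m).2 n)) n.
Qed.

Lemma acvg_unique s l l' : acvg s l -> acvg s l' -> l = l'.
Proof.
move=> h h'; apply/eqP; rewrite -subr_eq0; apply/eqP/afil_sep => P.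
have [[N hN] [N' hN']] := (h P, h' P).
have -> : l - l' = (s (maxn N N') - l') - (s (maxn N N') - l).
  by rewrite opprB [RHS]addrC subrKA.
by apply: afilB; [apply: hN'|apply: hN]; lia.
Qed.

Lemma acvgD s t l l' : acvg s l -> acvg t l' -> acvg (fun n => s n + t n) (l + l').
Proof.
move=> h h' P; have [[N hN] [N' hN']] := (h P, h' P); exists (maxn N N') => n hn.
by rewrite opprD addrACA; apply: afilD; [apply: hN|apply: hN']; lia.
Qed.

Lemma acvg_eventually s l N : (forall n, (N <= n)%N -> s n = l) -> acvg s l.
Proof. by move=> h P; exists N => n /h ->; rewrite subrr; exact: afil0. Qed.

Lemma superL_complete s :
  (forall P, exists N, forall n, (N <= n)%N -> afil P (s n.+1 - s n)) -> exists l, acvg s l.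
Proof.
move=> h; have [|l1 h1] := @laurent_complete R (fun n => (s n).1).
- by move=> P; have [N hN] := h P; exists N => n /hN[].
have [|l2 h2] := @laurent_complete R (fun n => (s n).2).
- by move=> P; have [N hN] := h P; exists N => n /hN[].
exists (l1, l2) => P; have [[N1 k1] [N2 k2]] := (h1 P, h2 P).
by exists (maxn N1 N2) => n hn; split; [apply: k1|apply: k2]; lia.
Qed.

Definition tnilp x := forall P, exists N, forall n, (N <= n)%N -> afil P (x ^+ n).

(** Only finitely many powers can leave level 0, and each of them has a bound of its own. *)
Lemma tnilp_bound x : tnilp x -> exists C, forall n, afil C (x ^+ n).
Proof.
move=> /(_ 0)[N hN].
suff [C hC] : exists C, forall n, (n < N)%N -> afil C (x ^+ n).
  exists (Order.min C 0) => n; have [lt|ge] := ltnP n N.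
    by apply: afil_le (hC n lt); lia.
  by apply: afil_le (hN n ge); lia.
elim: (N) => [|k [C hC]]; first by exists 0.
have [b hb] := afil_bound (x ^+ k); exists (Order.min C b) => n.
rewrite ltnS leq_eqVlt => /predU1P[->|lt]; first by apply: afil_le hb; lia.
by apply: afil_le (hC n lt); lia.
Qed.

(** For [n >= N + N'] each binomial term has one exponent past its threshold. The other factor lies
    in a uniform level by [tnilp_bound], and the thresholds are taken for the level shifted by that
    bound. *)
Lemma tnilpD x y : x * y = y * x -> tnilp x -> tnilp y -> tnilp (x + y).
Proof.
move=> xy tx ty P; have [[C hC] [C' hC']] := (tnilp_bound tx, tnilp_bound ty).
have [[N hN] [N' hN']] := (tx (P - C'), ty (P - C)).
exists (N + N')%N => n hn; rewrite exprDn_comm //; apply: afil_sum => i _.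
apply: afilMn; have [le|lt] := leqP N' i.
  by apply: afil_le (afilM (hC (n - i)%N) (hN' i le)); lia.
have le : (N <= n - i)%N by lia.
by apply: afil_le (afilM (hN (n - i)%N le) (hC' i)); lia.
Qed.

Lemma tnilp_nilp x k : x ^+ k = 0 -> tnilp x.
Proof.
by move=> xk P; exists k => n /subnK <-; rewrite exprD xk mulr0; exact: afil0.
Qed.

Lemma tnilp_fil x : afil 1 x -> tnilp x.
Proof.
move=> hx P; exists (absz P) => n hn.
by apply: afil_le (afilX n hx); lia.
Qed.

Definition rnilp (r : R) := exists k, r ^+ k = 0.

Lemma fst_peel x n c m : (x - m0 HR c m).1 n = if n == m then x.1 n - c else x.1 n.
Proof.
rewrite [LHS](_ : _ = x.1 n - mono c m n) // lcoef_mono.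
by case: ifP => // _; rewrite subr0.
Qed.

(** Induction on the number of degrees below 1 still occupied: the lowest monomial is nilpotent and
    commutes with the rest. In the end there remain a series of order at least 1 and a multiple of
    [zeta], whose square vanishes whatever its order. *)
Lemma tnilp_of_nilp x : aeven x -> (forall n, n < 1 -> rnilp (x.1 n)) -> tnilp x.
Proof.
move=> ex nx; suff H (k : nat) y : aeven y -> (forall n, n < 1 -> rnilp (y.1 n)) ->
    lfil (1 - k%:Z) y.1 -> tnilp y.
  by apply: (H (absz (1 - lbound x.1)%R)) => //; apply: lfil_le (@lfil_bound _ _); lia.
elim: k y => [|k IH] y ey ny fy.
  have -> : y = (y.1, 0) + (0, y.2).
    by apply: superL_eq; rewrite ?fstD ?sndD /= ?addr0 ?add0r.
  apply: tnilpD.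
  - by apply: aeven_comm; split; [exact: ey.1|exact: lodd0].
  - apply: tnilp_fil; split; last exact: lfil0.
    by rewrite -[1]subr0.
  - apply: (@tnilp_nilp _ 2); rewrite expr2; apply: superL_eq; rewrite ?fstM ?sndM /=.
      by rewrite mul0r.
    by rewrite mul0r lsig0 mulr0 addr0.
set m := - k%:Z; have [j cj] : rnilp (y.1 m) by apply: ny; rewrite /m; lia.
have em : aeven (m0 HR (y.1 m) m) by apply: aeven_m0; exact: ey.1.
rewrite -[y](subrK (m0 HR (y.1 m) m)); apply: tnilpD.
- by rewrite -aeven_comm.
- apply: IH; first by apply: aevenD => //; exact: aevenN.
  + move=> n hn; rewrite fst_peel; case: eqP => [->|_]; last exact: ny.
    by rewrite subrr; exists 1%N; rewrite expr1.
  + move=> n hn; rewrite fst_peel; case: eqP => [->|ne]; first by rewrite subrr.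
    by apply: fy; move: hn ne; rewrite /m; lia.
- by apply: (@tnilp_nilp _ j); rewrite m0X cj m0_0.
Qed.

Lemma lcoefX_lead (f : laurent R) m n : lfil m f -> lcoef (f ^+ n) (m * n%:Z) = f m ^+ n.
Proof.
move=> fm; elim: n => [|n IH]; first by rewrite !expr0 mulr0.
have fX k : lfil (m * k%:Z) (f ^+ k).
  elim: k => [|k IHk]; first by rewrite mulr0 expr0; exact: lfil_mono.
  by rewrite exprS intS mulrDr mulr1; exact: lmul_fil.
rewrite !exprS -IH.
have -> : m * n%:Z = m * n.+1%:Z - m by rewrite intS mulrDr mulr1 addrC addKr.
apply: lcoefM1 => i ne.
have [lt|ge] := ltP i m; first by rewrite fm ?mul0r.
by rewrite (fX n) ?mulr0 //; move: ne ge; rewrite intS mulrDr mulr1; lia.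
Qed.

(** If [c] is the lowest coefficient, in degree [m <= 0], then the [N]-th power has coefficient
    [c^N] in degree [m N <= 0], which vanishes for large [N]. The monomial is then nilpotent, and
    subtracting it preserves topological nilpotency. *)
Lemma nilp_of_tnilp x : aeven x -> tnilp x -> forall n, n < 1 -> rnilp (x.1 n).
Proof.
move=> ex tx; suff H (k : nat) y : aeven y -> tnilp y ->
    lfil (1 - k%:Z) y.1 -> forall n, n < 1 -> rnilp (y.1 n).
  by apply: (H (absz (1 - lbound x.1)%R)) => //; apply: lfil_le (@lfil_bound _ _); lia.
elim: k y => [|k IH] y ey ty fy n hn.
  by rewrite fy ?subr0 //; exists 1%N; rewrite expr1.
set m := - k%:Z; have fm : lfil m y.1 by apply: lfil_le fy; rewrite /m; lia.
have [N /(_ N (leqnn N))[hN _]] := ty 1.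
have cN : y.1 m ^+ N = 0.
  by rewrite -lcoefX_lead // -fstX hN // /m; nia.
have em : aeven (m0 HR (y.1 m) m) by apply: aeven_m0; exact: ey.1.
have [->|/eqP ne] := eqVneq n m; first by exists N.
have -> : y.1 n = (y - m0 HR (y.1 m) m).1 n.
  by rewrite fst_peel; case: eqP => // /ne.
apply: IH => //.
- by apply: aevenD => //; exact: aevenN.
- apply: tnilpD => //; first by apply: aeven_comm.
  apply: (@tnilp_nilp _ N); rewrite exprNn.
  by rewrite m0X cN m0_0 mulr0.
- move=> i hi; rewrite fst_peel; case: eqP => [->|ne']; first by rewrite subrr.
  by apply: fy; move: hi ne'; rewrite /m; lia.
Qed.

(** The geometric series converges by topological nilpotency, and its sum is even as a limit of even
    elements. *)
Lemma unit_1sub x : aeven x -> tnilp x ->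
  exists w, [/\ aeven w, (1 - x) * w = 1 & w * (1 - x) = 1].
Proof.
move=> ex tx; pose s n := \sum_(i < n) x ^+ i.
have [w sw] : exists w, acvg s w.
  apply: superL_complete => P; have [N hN] := tx P; exists N => n /hN h.
  by rewrite /s big_ord_recr /= addrAC subrr add0r.
have ew : aeven w.
  apply: acvg_even sw _ => n; apply: (big_ind (@aeven _ _ _ HR)) => [|y z|i _].
  - exact: aeven0.
  - exact: aevenD.
  - exact: aevenX.
have E : (1 - x) * w = 1.
  apply/eqP; rewrite -subr_eq0; apply/eqP/afil_sep => P.
  have [b hb] := afil_bound (1 - x); have [N1 h1] := sw (P - b); have [N2 h2] := tx P.
  set n := maxn N1 N2; have e : (1 - x) * s n = 1 - x ^+ n.
    by rewrite -opprB mulNr -subrX1 opprB.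
  have -> : (1 - x) * w - 1 = - ((1 - x) * (s n - w)) - x ^+ n.
    by rewrite mulrBr e opprB opprB addrA addrAC addrK.
  apply: afilB; last by apply: h2; rewrite /n; lia.
  apply: afilN; have h : afil (P - b) (s n - w) by apply: h1; rewrite /n; lia.
  by apply: afil_le (afilM hb h); lia.
by exists w; split=> //; rewrite aeven_comm.
Qed.

(** With [q = b z^-1], the even component of [1 - q x] has constant coefficient [1 - b x_1 = 0] and
    nilpotent coefficients in negative degrees, so [q x] is inverted by a geometric series. *)
Lemma unit_of_nilp x b : aeven x -> (forall n, n < 1 -> rnilp (x.1 n)) ->
  is_even ev b -> x.1 1 * b = 1 -> exists w, [/\ aeven w, x * w = 1 & w * x = 1].
Proof.
move=> ex nx eb xb; pose q := m0 HR b (-1).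
have eq : aeven q by exact: aeven_m0.
have eqx : aeven (q * x) by exact: aevenM.
have [||w [ew yw wy]] := @unit_1sub (1 - q * x).
- by apply: aevenD; [exact: aeven1|exact: aevenN].
- apply: tnilp_of_nilp; first by apply: aevenD; [exact: aeven1|exact: aevenN].
  move=> n hn; have -> : (1 - q * x).1 n = mono 1 0 n - b * x.1 (n + 1).
    by rewrite -[n + 1]/(n - -1) -lcoef_monoM.
  rewrite lcoef_mono; case: eqP => [->|ne].
    by rewrite add0r (even_commr HR) // xb subrr; exists 1%N; rewrite expr1.
  have [k hk] : rnilp (x.1 (n + 1)) by apply: nx; lia.
  exists k; rewrite sub0r exprNn exprMn_comm; last exact: (even_commr HR).
  by rewrite hk !mulr0.
exists (w * q); rewrite subKr in yw wy; split; first exact: aevenM.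
  by rewrite aeven_comm // -mulrA.
by rewrite -mulrA.
Qed.

End Topology.

(** * Substitution *)

Section IntPowers.
Variables (T : pzRingType) (x y : T).

Definition zpow (n : int) : T :=
  match n with Posz k => x ^+ k | Negz k => y ^+ k.+1 end.

Hypotheses (xy : x * y = 1) (yx : y * x = 1).

Lemma zpowN (k : nat) : zpow (- k%:Z) = y ^+ k.
Proof. by case: k => [|k] //; rewrite -NegzE. Qed.

Lemma zpowS n : zpow (n + 1) = x * zpow n.
Proof.
elim/int_ind: n => [|n _|n _]; first by rewrite add0r /= expr1 expr0 mulr1.
  by rewrite -PoszD addn1 /= !exprS.
have -> : - n.+1%:Z + 1 = - n%:Z by rewrite intS opprD addrAC addNr add0r.
by rewrite !zpowN exprS mulrA xy mul1r.
Qed.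

Lemma zpowP n : zpow (n - 1) = y * zpow n.
Proof. by rewrite -{2}[n](subrK 1) zpowS mulrA yx mul1r. Qed.

Lemma zpowD m n : zpow (m + n) = zpow m * zpow n.
Proof.
elim/int_ind: m => [|m IH|m IH]; first by rewrite add0r mul1r.
  by rewrite -addn1 PoszD zpowS addrAC zpowS IH mulrA.
rewrite -addn1 PoszD opprD zpowP addrAC zpowP IH mulrA //.
Qed.

End IntPowers.

Lemma zpow_morph (T U : pzRingType) (phi : T -> U) (x y : T) (n : int) :
  (forall a b, phi (a * b) = phi a * phi b) -> phi 1 = 1 ->
  phi (zpow x y n) = zpow (phi x) (phi y) n.
Proof.
move=> pM p1; have pX a k : phi (a ^+ k) = phi a ^+ k.
  by elim: k => [|k IH]; rewrite ?expr0 // !exprS pM IH.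
by case: n => k /=; rewrite pX.
Qed.

(** * Substitution of a pair, its multiplicativity and its chain rule *)

Section Substitution.
Variables (R : pzRingType) (ev od : {additive R -> R}) (HR : superring ev od).
Local Coercion lcoef : laurent >-> Funclass.
Local Notation A := (superL HR).
Local Notation sp := (spar ev od).
Local Notation m0 := (m0 HR).
Local Notation m1 := (m1 HR).
Implicit Types (x y z w l : A) (s t : nat -> A).

Definition aD (x : A) : A := ls_D ev od x.

Lemma fst_aD x : (aD x).1 = lsig ev od x.2. Proof. by []. Qed.
Lemma snd_aD x : (aD x).2 = lsig ev od (lder x.1). Proof. by []. Qed.

Lemma aDD x y : aD (x + y) = aD x + aD y.
Proof.
apply: superL_eq; rewrite ?(fst_aD, snd_aD, fstD, sndD) ?lsigD //.
by rewrite lderD lsigD.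
Qed.
Lemma acont_D : acont aD.
Proof.
split=> [|P]; first exact: aDD.
exists (Order.max P (P + 1)) => x [h1 h2]; split; apply: lfil_sig.
  by apply: lfil_le h2; lia.
move=> n hn /=; rewrite h1 ?mul0rz //; lia.
Qed.
Lemma aD_m0 r k : aD (m0 r k) = m1 (sp r *~ k) (k - 1).
Proof.
apply: superL_eq; rewrite ?(fst_aD, snd_aD) /= ?lsig0 // lder_mono lsig_mono.
by congr mono; rewrite /spar mulrzBl !raddfMz.
Qed.
Lemma aD_m1 r k : aD (m1 r k) = m0 (sp r) k.
Proof.
apply: superL_eq; rewrite ?(fst_aD, snd_aD) /= ?lsig_mono //.
by rewrite lder0 lsig0.
Qed.
Lemma aD_evenM x y : aeven x -> aD (x * y) = aD x * y + x * aD y.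
Proof.
move=> [e1 e2]; have e1' := leven_der e1.
apply: superL_eq; rewrite ?(fst_aD, snd_aD, fstD, sndD, fstM, sndM).
  by rewrite lsigD !(lsigM HR) (lsig_even HR e1) (lsig_odd HR e2) (lsigK HR) addrC.
rewrite lderM lsigD !(lsigM HR) (lsig_even HR e1) (lsig_even HR e1') (lsig_odd HR e2).
by rewrite (lsigK HR) mulNr [- _ + _]addrC addrACA addNr addr0.
Qed.
(** The derivation is odd, so it passes a scalar at the cost of the parity sign. *)
Lemma aD_cst r x : aD (m0 r 0 * x) = m0 (sp r) 0 * aD x.
Proof.
apply: superL_eq; rewrite ?(fst_aD, snd_aD, fstM, sndM) /= !mul0r !addr0.
  by rewrite (lsigM HR) lsig_mono.
rewrite lderM lder_mono mulr0z mono0 mul0r add0r (lsigM HR) lsig_mono.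
by [].
Qed.
Lemma aD_odd x : aodd x -> aeven (aD x).
Proof.
move=> [h1 h2]; split; first exact: (leven_sig HR).
by apply: (lodd_sig HR); exact: lodd_der.
Qed.

Section Subst.
Variables (Z W T : A).
Hypotheses (eZ : aeven Z) (eW : aeven W) (oT : aodd T).
Hypotheses (ZW : Z * W = 1) (WZ : W * Z = 1) (tZ : tnilp Z).
Local Notation zp := (zpow Z W).

Lemma aeven_zpow n : aeven (zp n).
Proof. by case: n => k; exact: aevenX. Qed.

Lemma aD_zpow n : aD (zp n) = (zp (n - 1) * aD Z) *~ n.
Proof.
have D1 : aD 1 = 0 by rewrite -m0_1 aD_m0 mulr0z m1_0.
have DW : aD W = - (W * W * aD Z).
  have := congr1 (fun x => W * aD x) WZ; rewrite aD_evenM // D1 mulr0 mulrDr.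
  rewrite -(aeven_comm (aD W) eZ) mulrA WZ mul1r mulrA.
  by move/eqP; rewrite addr_eq0 => /eqP.
elim/int_ind: n => [|n IH|n IH]; first by rewrite mulr0z.
  rewrite -addn1 PoszD zpowS // aD_evenM // IH addrK mulrzAr mulrA -zpowS // subrK.
  by rewrite (aeven_comm _ (aeven_zpow n)) -(aeven_comm _ (aeven_zpow n)) mulrzDr addrC.
rewrite -addn1 PoszD opprD; set N := - n%:Z in IH *.
have E1 : W * zp (N - 1) = zp (N - 1 - 1) by rewrite -zpowP.
have E2 : W * W * zp N = zp (N - 1 - 1) by rewrite -mulrA -!zpowP.
rewrite (zpowP ZW WZ N) // aD_evenM // IH DW mulrzAr mulrA E1 mulNr -(mulrA (W * W)).
by rewrite -(aeven_comm (aD Z) (aeven_zpow N)) mulrA E2 mulrzBr addrC.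
Qed.

Definition sterm (x : A) (n : int) : A :=
  m0 (x.1 n) 0 * zp n + m0 (x.2 n) 0 * (zp n * T).

(** The window [[-n, n)] exhausts all degrees without reference to the order of [x], which makes the
    partial sums additive in [x]. *)
Definition spsum (x : A) (n : nat) : A := \sum_(i < n.*2) sterm x (i%:Z - n%:Z).

Lemma zpow_fil P : exists N : int, forall n, N <= n -> afil P (zp n).
Proof.
have [N hN] := tZ P; exists N%:Z => -[k|k] h //; apply: hN; lia.
Qed.

Lemma sterm_fil P : exists N : int, forall n x, N <= n -> afil P (sterm x n).
Proof.
have [b hb] := afil_bound T; have [N1 h1] := zpow_fil P.
have [N2 h2] := zpow_fil (P - b); exists (Order.max N1 N2) => n x hn.
have c (y : A) (r : R) Q : afil Q y -> afil Q (m0 r 0 * y).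
  by move=> hy; rewrite -[Q]add0r; apply: afilM => //; exact: afil_m0.
apply: afilD; apply: c; first by apply: h1; lia.
by rewrite -[P](subrK b); apply: afilM => //; apply: h2; lia.
Qed.

Lemma sterm0 x n : x.1 n = 0 -> x.2 n = 0 -> sterm x n = 0.
Proof. by rewrite /sterm => -> ->; rewrite m0_0 !mul0r addr0. Qed.

Lemma spsumS x n :
  spsum x n.+1 = sterm x (- n.+1%:Z) + spsum x n + sterm x n%:Z.
Proof.
rewrite /spsum doubleS big_ord_recl big_ord_recr /= addrA; congr (_ + _ + _).
- by rewrite sub0r.
- by apply: eq_bigr => i _; congr sterm; rewrite /bump /=; lia.
- by congr sterm; rewrite /bump /=; lia.
Qed.

Lemma spsum_cvg x : exists l, acvg (spsum x) l.
Proof.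
apply: superL_complete => P; have [N hN] := sterm_fil P.
exists (absz N + absz (lbound x.1) + absz (lbound x.2))%N => n hn.
(* Past both lower bounds the new term of negative degree vanishes; only the one of degree [n]
   remains, and it tends to zero. *)
rewrite spsumS sterm0 ?lboundP //; try lia.
by rewrite add0r addrC addKr; apply: hN; lia.
Qed.

Definition asubst (x : A) : A := projT1 (cid (spsum_cvg x)).

Lemma asubst_cvg x : acvg (spsum x) (asubst x).
Proof. exact: projT2 (cid (spsum_cvg x)). Qed.

Lemma stermD x y n : sterm (x + y) n = sterm x n + sterm y n.
Proof.
rewrite /sterm fstD sndD !lcoefD !m0D !mulrDl.
exact: addrACA.
Qed.

Lemma asubstD x y : asubst (x + y) = asubst x + asubst y.
Proof.
apply: acvg_unique (asubst_cvg _) _.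
have := acvgD (asubst_cvg x) (asubst_cvg y); congr (acvg _ _); apply: funext => n.
by rewrite /spsum -big_split; apply: eq_bigr => i _; rewrite stermD.
Qed.

Lemma sterm_out_fil P : exists N : int, forall x M, N <= M -> afil M x ->
  forall n, afil P (sterm x n).
Proof.
have [N hN] := sterm_fil P; exists N => x M hM [h1 h2] n.
have [le|lt] := leP N n; first exact: hN.
by rewrite sterm0 ?(h1, h2) //; [exact: afil0|lia|lia].
Qed.

Lemma acont_subst : acont asubst.
Proof.
split=> [|P]; first exact: asubstD.
have [N hN] := sterm_out_fil P; exists N => x hx.
by apply: acvg_fil (asubst_cvg x) _ => n; apply: afil_sum => i _; exact: (hN x N).
Qed.

Lemma spsum_mono x k : (forall n, n != k -> x.1 n = 0 /\ x.2 n = 0) ->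
  asubst x = sterm x k.
Proof.
move=> hx; apply: acvg_unique (asubst_cvg x) _.
apply: (@acvg_eventually _ _ _ _ _ _ (absz k).+1) => n hn.
have hi : (absz (k + n%:Z)%R < n.*2)%N by lia.
rewrite /spsum (bigD1 (Ordinal hi)) //= big1 ?addr0.
  by congr sterm; lia.
move=> i ne; have [] := hx (i%:Z - n%:Z); last exact: sterm0.
by apply: contra ne => /eqP e; apply/eqP/val_inj => /=; lia.
Qed.

Lemma asubst_m0 r k : asubst (m0 r k) = m0 r 0 * zp k.
Proof.
rewrite (@spsum_mono _ k) /sterm /= ?if_same ?eqxx ?m0_0 ?mul0r ?addr0 //.
by move=> n /negbTE ne /=; rewrite ne if_same.
Qed.

Lemma asubst_m1 r k : asubst (m1 r k) = m0 r 0 * (zp k * T).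
Proof.
rewrite (@spsum_mono _ k) /sterm /= ?if_same ?eqxx ?m0_0 ?mul0r ?add0r //.
by move=> n /negbTE ne /=; rewrite ne if_same.
Qed.

Lemma asubst1 : asubst 1 = 1.
Proof. by rewrite -m0_1 asubst_m0 m0_1 mul1r. Qed.

Lemma asubst_z : asubst (m0 1 1) = Z.
Proof. by rewrite asubst_m0 m0_1 mul1r. Qed.

Lemma asubst_zeta : asubst (m1 1 0) = T.
Proof. by rewrite asubst_m1 m0_1 !mul1r. Qed.

(** On monomials three facts suffice: integer powers of [Z] are even, hence central; [T] passes
    scalars with the parity sign, as [zeta] does; and [T^2 = 0] mirrors [zeta^2 = 0]. *)
Lemma asubstM x y : asubst (x * y) = asubst x * asubst y.
Proof.
have cS := acont_subst; have zc n w : zp n * w = w * zp n.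
  by apply: aeven_comm; exact: aeven_zpow.
move: x; apply: acont_ext.
- by apply: (acont_comp cS); exact: acont_mulr.
- by apply: (@acont_comp _ _ _ _ (fun x => x * asubst y)) => //; exact: acont_mulr.
- move=> r k; move: y; apply: acont_ext.
  + by apply: (acont_comp cS); exact: acont_mull.
  + by apply: (@acont_comp _ _ _ _ (fun x => _ * x)) => //; exact: acont_mull.
  + move=> s l; rewrite m0M !asubst_m0 zpowD // -[m0 (r * s) 0](m0M _ r s 0 0) -!mulrA.
    by congr (_ * _); rewrite [RHS]mulrA (zc k (m0 s 0)) -mulrA.
  + move=> s l; rewrite m0M1 asubst_m0 !asubst_m1 zpowD // -[m0 (r * s) 0](m0M _ r s 0 0).
    by rewrite -!mulrA; congr (_ * _); rewrite [RHS]mulrA (zc k (m0 s 0)) -!mulrA.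
- move=> r k; move: y; apply: acont_ext.
  + by apply: (acont_comp cS); exact: acont_mull.
  + by apply: (@acont_comp _ _ _ _ (fun x => _ * x)) => //; exact: acont_mull.
  + move=> s l; rewrite m1M0 asubst_m0 !asubst_m1 zpowD // -[m0 (r * _) 0](m0M _ r _ 0 0).
    rewrite -!mulrA; congr (_ * _); rewrite [T * (_ * _)]mulrA (aodd_m0 s oT).
    by rewrite -[m0 _ 0 * T * _]mulrA -(zc l T) [RHS]mulrA (zc k (m0 _ 0)) -!mulrA.
  + move=> s l; rewrite m1M (acont0 cS) !asubst_m1 -!mulrA [T * (_ * _)]mulrA (aodd_m0 s oT).
    by rewrite -!mulrA [T * (_ * _)]mulrA -(zc l) -mulrA (aodd_sqr oT) !mulr0.
Qed.

Lemma asubst_cst r x : asubst (m0 r 0 * x) = m0 r 0 * asubst x.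
Proof. by rewrite asubstM asubst_m0 mulr1. Qed.

Lemma asubst_even x : aeven x -> aeven (asubst x).
Proof.
move=> [e1 e2]; apply: acvg_even (asubst_cvg x) _ => n.
apply: (big_ind (@aeven _ _ _ HR)) => [|y z|i _]; [exact: aeven0|exact: aevenD|].
apply: aevenD; first by apply: aevenM; [exact: aeven_m0|exact: aeven_zpow].
by apply: aoddM; [exact: aodd_m0_odd|apply: aeven_oddM => //; exact: aeven_zpow].
Qed.

Lemma asubst_odd x : aodd x -> aodd (asubst x).
Proof.
move=> [e1 e2]; apply: acvg_odd (asubst_cvg x) _ => n.
apply: (big_ind (@aodd _ _ _ HR)) => [|y z|i _]; [exact: aodd0|exact: aoddD|].
apply: aoddD; first by apply: aodd_evenM; [exact: aodd_m0_odd|exact: aeven_zpow].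
by apply: aeven_oddM; [exact: aeven_m0|apply: aeven_oddM => //; exact: aeven_zpow].
Qed.

(** On [z^k] the hypothesis turns [k Z^(k-1) D Z] into [k Z^(k-1) T] times [D T], the image of
    [D z^k] times [D T]. On [z^k zeta] the derivative of the power contributes a term containing
    [T^2 = 0]. *)
Lemma aD_subst x : aD Z = T * aD T -> aD (asubst x) = asubst (aD x) * aD T.
Proof.
move=> DZ; have cS := acont_subst; have eT := aD_odd oT; move: x; apply: acont_ext.
- exact: (acont_comp acont_D).
- apply: (@acont_comp _ _ _ _ (fun x => x * aD T)); first exact: acont_mulr.
  exact: acont_comp cS acont_D.
- move=> r k; rewrite asubst_m0 aD_cst aD_zpow aD_m0 asubst_m1 DZ.
  rewrite (_ : m0 (sp r *~ k) 0 = m0 (sp r) 0 *~ k) ?mulrzAl ?mulrzAr ?mulrA //.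
  elim/int_ind: k => [|k IH|k IH]; first by rewrite !mulr0z m0_0.
    by rewrite !intS !mulrzDr m0D IH.
  by rewrite !intS opprD !mulrzDr m0D IH !mulrN1z; congr (_ + _); apply: superL_eq;
    apply: laurentP => n //=; case: ifP; rewrite ?oppr0.
- move=> r k; rewrite asubst_m1 aD_cst aD_m1 asubst_m0 -!mulrA; congr (_ * _).
  rewrite (aD_evenM _ (aeven_zpow k)) aD_zpow DZ.
  by rewrite mulrzAl -!mulrA (aeven_comm _ eT) [T * (T * _)]mulrA (aodd_sqr oT) mul0r mulr0 mul0rz add0r.
Qed.

End Subst.
End Substitution.

(** * Nilpotent perturbations *)

Section Invertibility.
Variables (R : pzRingType) (ev od : {additive R -> R}) (HR : superring ev od).
Local Coercion lcoef : laurent >-> Funclass.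
Local Notation A := (superL HR).
Local Notation sp := (spar ev od).
Local Notation m0 := (m0 HR).
Local Notation m1 := (m1 HR).
Implicit Types (x y z w l : A) (s t : nat -> A) (F G : A -> A).

Definition ahomeo F := exists G, [/\ cancel F G, cancel G F &
  forall P, exists N, forall x, afil N x -> afil P (G x)].

Definition alinear F := forall r x, F (m0 r 0 * x) = m0 r 0 * F x.

(* [F = F0 (1 - t)] where [t^j] takes values in [r^j A], so [t] is nilpotent. *)
Lemma ahomeo_perturb F F0 r k : acont F -> alinear F -> acont F0 -> alinear F0 ->
  ahomeo F0 -> r ^+ k = 0 -> (forall x, exists y, F0 x - F x = m0 r 0 * y) -> ahomeo F.
Proof.
move=> cF lF cF0 lF0 [G0 [FG GF G0c]] rk dvd.
have G0D x y : G0 (x + y) = G0 x + G0 y.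
  by apply: (can_inj FG); rewrite cF0.1 !GF.
have cG0 : acont G0 by [].
have lG0 : alinear G0 by move=> c x; apply: (can_inj FG); rewrite lF0 !GF.
pose t x := G0 (F0 x - F x).
have ct : acont t.
  split=> [x y|P]; first by rewrite /t -G0D cF0.1 cF.1 opprD addrACA.
  have [N hN] := G0c P; have [[N1 h1] [N2 h2]] := (cF0.2 N, cF.2 N).
  exists (Order.max N1 N2) => x hx; apply: hN.
  by apply: afilB; [apply: h1|apply: h2]; apply: afil_le hx; lia.
have cti j : acont (iter j t).
  by elim: j => [|j IH]; [exact: acont_id|exact: (acont_comp ct IH)].
have lt : alinear t by move=> c x; rewrite /t lF0 lF -mulrBr lG0.
(* Linearity moves [r^j] outside, and each further application of [t] contributes one more factor
   [r]. *)
have tj j x : exists y, iter j t x = m0 (r ^+ j) 0 * y.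
  elim: j => [|j [y hy]]; first by exists x; rewrite expr0 mul1r.
  have [y' hy'] := dvd y; exists (G0 y').
  by rewrite iterS hy lt /t hy' lG0 mulrA m0M exprSr.
have tk x : iter k t x = 0 by have [y ->] := tj k x; rewrite rk m0_0 mul0r.
have Ft x : F x = F0 (x - t x) by rewrite acontB // /t GF subKr.
(* Since [t^k = 0], the truncated geometric series inverts [1 - t] exactly. *)
have tel x : \sum_(j < k) iter j t (x - t x) = x.
  under eq_bigr => j _ do rewrite acontB // -iterSr.
  suff -> n : \sum_(j < n) (iter j t x - iter j.+1 t x) = x - iter n t x.
    by rewrite tk subr0.
  by elim: n => [|n IH]; rewrite ?big_ord0 ?subrr // big_ord_recr /= IH subrKA.
pose G y := \sum_(j < k) iter j t (G0 y).
have cG : acont G.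
  rewrite /G; elim: (k) => [|j IH].
    by split=> [x y|P]; [rewrite !big_ord0 addr0 | exists 0 => x _; rewrite big_ord0; exact: afil0].
  have := acontD IH (acont_comp (cti j) cG0); congr acont; apply: funext => y.
  by rewrite big_ord_recr.
exists G; split; last exact: cG.2.
- by move=> x; rewrite /G Ft FG tel.
- move=> y; rewrite Ft -[RHS]GF; congr (F0 _); rewrite -[RHS]tel /G.
  rewrite (big_morph t ct.1 (acont0 ct)) -sumrB; apply: eq_bigr => j _.
  by rewrite acontB // -iterSr iterS.
Qed.

Definition homog (r : R) := is_even ev r \/ is_odd od r.

(** * The two-sided ideal generated by a homogeneous element *)

Section CoefIdeal.
Variable r : R.
Hypothesis hr : homog r.

Definition rdvd (c : R) := exists a, c = r * a.
(** Membership is tested coefficientwise, a form stable under limits; [coefin_div] recovers an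
    actual factor [r]. *)
Definition coefin x := forall n, rdvd (x.1 n) /\ rdvd (x.2 n).

Lemma rdvd0 : rdvd 0. Proof. by exists 0; rewrite mulr0. Qed.
Lemma rdvdD c d : rdvd c -> rdvd d -> rdvd (c + d).
Proof. by move=> [a ->] [b ->]; exists (a + b); rewrite mulrDr. Qed.
Lemma rdvdN c : rdvd c -> rdvd (- c).
Proof. by move=> [a ->]; exists (- a); rewrite mulrN. Qed.
Lemma rdvdMr c d : rdvd c -> rdvd (c * d).
Proof. by move=> [a ->]; exists (a * d); rewrite mulrA. Qed.
(** A homogeneous [r] can be moved to the left of any factor, at the price of a parity twist when
    [r] is odd; hence [r R] is two-sided. *)
Lemma rdvdMl c d : rdvd c -> rdvd (d * c).
Proof.
move=> [a ->]; case: hr => h.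
  by exists (d * a); rewrite !mulrA (even_commr HR d h).
by exists (sp d * a); rewrite !mulrA (odd_mul_spar HR d h).
Qed.
Lemma rdvd_spar c : rdvd c -> rdvd (sp c).
Proof.
move=> [a ->]; rewrite (sparM HR); apply: rdvdMr; case: hr => h.
  by rewrite (spar_even HR h) -[r]mulr1; exists 1.
by rewrite (spar_odd HR h); apply: rdvdN; exists 1; rewrite mulr1.
Qed.

Lemma coefin0 : coefin 0.
Proof. by move=> n; rewrite lcoef0; split; exact: rdvd0. Qed.
Lemma coefinD x y : coefin x -> coefin y -> coefin (x + y).
Proof. by move=> hx hy n; case: (hx n) (hy n) => ? ? [? ?]; split; exact: rdvdD. Qed.
Lemma coefinMl x y : coefin x -> coefin (y * x).
Proof.
move=> hx n; split.
  apply: (@lcoefM_in _ rdvd) => [|c d|i]; [exact: rdvd0|exact: rdvdD|].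
  by apply: rdvdMl; case: (hx (n - i)).
apply: rdvdD; apply: (@lcoefM_in _ rdvd) => [|c d|i]; try exact: rdvd0; try exact: rdvdD.
  by apply: rdvdMl; case: (hx (n - i)).
by apply: rdvdMl; apply: rdvd_spar; case: (hx (n - i)).
Qed.
Lemma coefinMr x y : coefin x -> coefin (x * y).
Proof.
move=> hx n; split.
  apply: (@lcoefM_in _ rdvd) => [|c d|i]; [exact: rdvd0|exact: rdvdD|].
  by apply: rdvdMr; case: (hx i).
apply: rdvdD; apply: (@lcoefM_in _ rdvd) => [|c d|i]; try exact: rdvd0; try exact: rdvdD.
  by apply: rdvdMr; case: (hx i).
by apply: rdvdMr; case: (hx i).
Qed.
Lemma coefinN x : coefin x -> coefin (- x).
Proof. by move=> hx; rewrite -mulN1r; exact: coefinMl. Qed.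

Lemma laurent_div (f : laurent R) : (forall n, rdvd (f n)) ->
  exists g : laurent R, forall n, f n = r * g n.
Proof.
(* The quotient is required to vanish where [f] does, since arbitrary quotients need not have a
   lower bound. *)
move=> hf; have /choice[g hg] : forall n, exists a, f n = r * a /\ (f n = 0 -> a = 0).
  move=> n; case: (eqVneq (f n) 0) => [->|/eqP ne]; first by exists 0; rewrite mulr0.
  by have [a ha] := hf n; exists a.
have lg : is_laurent g.
  by exists (lbound f) => n hn; apply: (hg n).2; exact: lboundP.
by exists (exist _ g lg) => n; exact: (hg n).1.
Qed.

Lemma coefin_div x : coefin x -> exists y, x = m0 r 0 * y.
Proof.
move=> hx; have [g1 h1] := laurent_div (fun n => (hx n).1).
have [g2 h2] := laurent_div (fun n => (hx n).2).
by exists (g1, g2); rewrite m0_scale; apply: superL_eq; apply: laurentP => n /=.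
Qed.

Lemma coefin_m0 k : coefin (m0 r k).
Proof.
move=> n; split=> /=; case: ifP => _; try exact: rdvd0.
by exists 1; rewrite mulr1.
Qed.
Lemma coefin_m1 k : coefin (m1 r k).
Proof.
move=> n; split=> /=; case: ifP => _; try exact: rdvd0.
by exists 1; rewrite mulr1.
Qed.

(** The congruence passes from [Z] to its inverse through [W - W' = - W (Z - Z') W'], then to
    integer powers, terms and partial sums, and finally to the limit coefficient by coefficient. *)
Lemma coefin_subst Z W T Z' W' T' (tZ : tnilp Z) (tZ' : tnilp Z') :
  Z * W = 1 -> W * Z = 1 -> Z' * W' = 1 -> W' * Z' = 1 ->
  coefin (Z - Z') -> coefin (T - T') ->
  forall x, coefin (asubst W T tZ x - asubst W' T' tZ' x).
Proof.
move=> ZW WZ ZW' WZ' hZ hT x.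
have mulB (a b a' b' : A) : coefin (a - a') -> coefin (b - b') -> coefin (a * b - a' * b').
  move=> ha hb; rewrite -[a * b](subrK (a' * b)) -mulrBl -addrA -mulrBr.
  by apply: coefinD; [exact: coefinMr|exact: coefinMl].
have c0 y : coefin (y - y) by rewrite subrr; exact: coefin0.
have hW : coefin (W - W').
  have -> : W - W' = - (W * (Z - Z') * W').
    by rewrite mulrBr mulrBl WZ mul1r -mulrA ZW' mulr1 opprB.
  by apply: coefinN; apply: coefinMr; exact: coefinMl.
have hX (a b : A) k : coefin (a - b) -> coefin (a ^+ k - b ^+ k).
  by move=> h; elim: k => [|k IH]; rewrite ?expr0 // !exprS; exact: mulB.
have hz n : coefin (zpow Z W n - zpow Z' W' n) by case: n => k; exact: hX.
have hs n : coefin (sterm Z W T x n - sterm Z' W' T' x n).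
  by rewrite /sterm opprD addrACA; apply: coefinD; apply: (mulB) => //; exact: (mulB).
have hp n : coefin (spsum Z W T x n - spsum Z' W' T' x n).
  rewrite /spsum -sumrB; apply: (big_ind coefin) => // [|y z].
    exact: coefin0.
  exact: coefinD.
apply: (@acvg_coef_in _ _ _ _ rdvd rdvd
  (fun n => spsum Z W T x n - spsum Z' W' T' x n)) => // P.
have [[N h] [N' h']] := (asubst_cvg W T tZ x P, asubst_cvg W' T' tZ' x P).
exists (maxn N N') => n hn.
rewrite [X in afil _ X](_ : _ = (spsum Z W T x n - asubst W T tZ x)
   - (spsum Z' W' T' x n - asubst W' T' tZ' x)).
  by apply: afilB; [apply: h|apply: h']; lia.
by rewrite !opprD addrACA.

Qed.

End CoefIdeal.

End Invertibility.

(** * Triangular substitutions *)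

Lemma zpowV (T : pzRingType) (a b : T) n : a * b = 1 -> b * a = 1 ->
  zpow a b n * zpow b a n = 1.
Proof.
move=> ab ba; have H (x y : T) k : x * y = 1 -> x ^+ k * y ^+ k = 1.
  move=> xy; elim: k => [|k IH]; first by rewrite mulr1.
  by rewrite exprSr exprS mulrA -[x ^+ k * x * y]mulrA xy mulr1.
by case: n => k; exact: H.
Qed.

Section Coefficients.
Variables (R : pzRingType) (ev od : {additive R -> R}) (HR : superring ev od).
Local Coercion lcoef : laurent >-> Funclass.
Local Notation m0 := (m0 HR).
Local Notation m1 := (m1 HR).
Implicit Types x y : superL HR.

Lemma fst_m0 r k n : (m0 r k).1 n = if n == k then r else 0. Proof. by []. Qed.
Lemma snd_m0 r k n : (m0 r k).2 n = 0. Proof. exact: lcoef0. Qed.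
Lemma fst_m1 r k n : (m1 r k).1 n = 0. Proof. exact: lcoef0. Qed.
Lemma snd_m1 r k n : (m1 r k).2 n = if n == k then r else 0. Proof. by []. Qed.
Lemma fst_coefD x y n : (x + y).1 n = x.1 n + y.1 n. Proof. by []. Qed.
Lemma snd_coefD x y n : (x + y).2 n = x.2 n + y.2 n. Proof. by []. Qed.
Lemma fst_coefB x y n : (x - y).1 n = x.1 n - y.1 n. Proof. by []. Qed.
Lemma snd_coefB x y n : (x - y).2 n = x.2 n - y.2 n. Proof. by []. Qed.
End Coefficients.

Local Notation coefE := (fst_coefB, snd_coefB, fst_coefD, snd_coefD,
  fst_m0, snd_m0, fst_m1, snd_m1).

Section Triangular.
Variables (R : pzRingType) (ev od : {additive R -> R}) (HR : superring ev od).
Local Coercion lcoef : laurent >-> Funclass.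
Local Notation A := (superL HR).
Local Notation m0 := (m0 HR).
Local Notation m1 := (m1 HR).
Implicit Types (x y z w l : A) (F G : A -> A).

Lemma afil_peel P x : afil P x -> afil (P + 1) (x - m0 (x.1 P) P - m1 (x.2 P) P).
Proof.
move=> [h1 h2]; split=> n hn; rewrite !coefE ?subr0.
  by case: eqP => [->|ne]; rewrite ?subrr // h1 ?subr0 //; lia.
by case: eqP => [->|ne]; rewrite ?subrr // h2 ?subr0 //; lia.
Qed.

Lemma afil_succ P x : afil P x -> x.1 P = 0 -> x.2 P = 0 -> afil (P + 1) x.
Proof.
by move=> /afil_peel h e1 e2; move: h; rewrite e1 e2 m0_0 m1_0 !subr0.
Qed.

(** * Filtered maps that are invertible on the graded pieces *)

Section Graded.
(** [E0 P] and [E1 P] are the symbols of [F] on [z^P] and [z^P zeta]. They multiply on the right, as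
    befits a map that is linear for left scalars. *)
Variables (F : A -> A) (E0 E1 E0' E1' : int -> R).
Hypothesis cF : acont F.
Hypothesis Ffil : forall P x, afil P x -> afil P (F x).
Hypothesis F0 : forall r P, afil (P + 1) (F (m0 r P) - m0 (r * E0 P) P).
Hypothesis F1 : forall r P, afil (P + 1) (F (m1 r P) - m1 (r * E1 P) P).
Hypotheses (E0K : forall P, E0 P * E0' P = 1) (E0K' : forall P, E0' P * E0 P = 1).
Hypotheses (E1K : forall P, E1 P * E1' P = 1) (E1K' : forall P, E1' P * E1 P = 1).

Lemma graded_lead P x : afil P x ->
  afil (P + 1) (F x - m0 (x.1 P * E0 P) P - m1 (x.2 P * E1 P) P).
Proof.
move=> /afil_peel/Ffil h; have := afilD (afilD h (F0 (x.1 P) P)) (F1 (x.2 P) P).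
rewrite !(acontB _ _ cF); congr (afil _ _); set a := F x; set b := F (m0 _ _); set c := F (m1 _ _).
by rewrite (addrAC (a - b)) !subrKA.
Qed.

Lemma graded_succ P x : afil P x -> afil (P + 1) (F x) -> afil (P + 1) x.
Proof.
move=> hx hF; have [h1 h2] := graded_lead hx; case: hF => hF1 hF2.
have lt : P < P + 1 by rewrite ltrDl.
apply: afil_succ => //.
  move: (h1 P lt); rewrite !coefE eqxx hF1 // subr0 sub0r => /eqP; rewrite oppr_eq0 => /eqP.
  by move/(congr1 (fun c => c * E0' P)); rewrite mul0r -mulrA E0K mulr1.
move: (h2 P lt); rewrite !coefE eqxx hF2 // subr0 sub0r => /eqP; rewrite oppr_eq0 => /eqP.
by move/(congr1 (fun c => c * E1' P)); rewrite mul0r -mulrA E1K mulr1.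
Qed.

(** From any initial level of [x], invertibility of the symbols gains one level at a time. This
    yields both injectivity, by separatedness, and continuity of the inverse. *)
Lemma graded_reflect P x : afil P (F x) -> afil P x.
Proof.
move=> hF; have [Q hQ] := afil_bound x.
have [le|lt] := leP P Q; first exact: afil_le le hQ.
suff H k : (k <= absz (P - Q)%R)%N -> afil (Q + k%:Z) x.
  by have := H _ (leqnn _); apply: afil_le; lia.
elim: k => [|k IH] hk; first by rewrite addr0.
rewrite -addn1 PoszD addrA; apply: graded_succ; first by apply: IH; lia.
by apply: afil_le hF; lia.
Qed.

(** An element of degree [P] whose image has the same leading part as [w]; a preimage is the
    convergent sum of such corrections. *)
Definition gcorr (P : int) (w : A) : A := m0 (w.1 P * E0' P) P + m1 (w.2 P * E1' P) P.

Lemma gcorr_fil P w : afil P (gcorr P w).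
Proof. by apply: afilD; [exact: afil_m0|exact: afil_m1]. Qed.

Lemma gcorrP P w : afil P w -> afil (P + 1) (w - F (gcorr P w)).
Proof.
move=> hw; have := afilB (afil_peel hw) (graded_lead (gcorr_fil P w)).
have -> : (gcorr P w).1 P * E0 P = w.1 P.
  by rewrite /gcorr !coefE eqxx addr0 -mulrA E0K' mulr1.
have -> : (gcorr P w).2 P * E1 P = w.2 P.
  by rewrite /gcorr !coefE eqxx add0r -mulrA E1K' mulr1.
congr (afil _ _); set f := F _; set a := m0 _ _; set b := m1 _ _.
by rewrite -(addrA w) -(addrA f) opprD addrACA subrr addr0.
Qed.

Lemma graded_surj y : exists x, F x = y.
Proof.
have [Q hQ] := afil_bound y.
pose s := fix s (k : nat) : A :=
  if k is k'.+1 then s k' + gcorr (Q + k'%:Z) (y - F (s k')) else 0.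
have hs k : afil (Q + k%:Z) (y - F (s k)).
  elim: k => [|k IH]; first by rewrite addr0 /= (acont0 cF) subr0.
  by rewrite -addn1 PoszD addrA addn1 /= cF.1 opprD addrA; exact: gcorrP.
have [x sx] : exists x, acvg s x.
  apply: superL_complete => P; exists (absz (P - Q)%R) => n hn.
  rewrite /= addrAC subrr add0r; apply: afil_le (gcorr_fil _ _); lia.
exists x; apply/eqP; rewrite eq_sym -subr_eq0; apply/eqP/afil_sep => P.
have [N hN] := sx P; set n := maxn N (absz (P - Q)%R).
rewrite -[y](subrK (F (s n))) -addrA -acontB //; apply: afilD.
  by apply: afil_le (hs n); rewrite /n; lia.
by apply: Ffil; apply: hN; rewrite /n; lia.
Qed.

Lemma graded_homeo : ahomeo F.
Proof.
have /choice[G hG] := graded_surj.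
exists G; split=> // [x|P]; last first.
  by exists P => x hx; apply: graded_reflect; rewrite hG.
apply/eqP; rewrite -subr_eq0; apply/eqP/afil_sep => P; apply: graded_reflect.
by rewrite acontB // hG subrr; exact: afil0.
Qed.

End Graded.

Definition lead x (a : R) (p : int) := afil (p + 1) (x - m0 a p).

Lemma lead_fil x a p : lead x a p -> afil p x.
Proof.
move=> h; rewrite -[x](subrK (m0 a p)); apply: afilD; last exact: afil_m0.
by apply: afil_le h; rewrite lerDl.
Qed.

Lemma leadM x y a b p q : lead x a p -> lead y b q -> lead (x * y) (a * b) (p + q).
Proof.
move=> hx hy; rewrite /lead -m0M.
have -> : x * y - m0 a p * m0 b q = (x - m0 a p) * y + m0 a p * (y - m0 b q).
  by rewrite mulrBl mulrBr subrKA.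
apply: afilD.
  by rewrite addrAC; apply: afilM => //; exact: lead_fil hy.
by rewrite -addrA; apply: afilM => //; exact: afil_m0.
Qed.

Lemma leadX x a p k : lead x a p -> lead (x ^+ k) (a ^+ k) (p * k%:Z).
Proof.
move=> h; elim: k => [|k IH]; last by rewrite !exprS intS mulrDr mulr1; exact: leadM.
by rewrite !expr0 mulr0 /lead m0_1 subrr; exact: afil0.
Qed.

(** In [w = b z^-1 - w y] the factor [y] has level 1, so any level of [w] below [-1] improves by
    one. Iteration from an arbitrary bound reaches level [-1], and the same identity then gives the
    leading term. *)
Lemma lead_inv x w a b : lead x a 1 -> a * b = 1 -> w * x = 1 -> lead w b (-1).
Proof.
move=> hx ab wx; pose y := x * m0 b (-1) - 1.
have hy : afil 1 y.
  have -> : y = (x - m0 a 1) * m0 b (-1) by rewrite mulrBl m0M ab.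
  by apply: (afilM (P := 2) (Q := -1)); [exact: hx|exact: afil_m0].
have wE : w = m0 b (-1) - w * y by rewrite /y mulrBr mulrA wx mul1r mulr1 subKr.
suff hw : afil (-1) w.
  have e : w - m0 b (-1) = - (w * y) by rewrite [X in X - _]wE addrC addKr.
  by rewrite /lead e; apply: afilN; exact: afilM hw hy.
have [Q hQ] := afil_bound w; pose k := absz (Q + 1)%R.
suff H j : afil (Order.min (-1) (Q + j%:Z)) w.
  by apply: afil_le (H k); rewrite /k; lia.
elim: j => [|j IH]; first by apply: afil_le hQ; lia.
rewrite wE; apply: afilB; first by apply: afil_le (afil_m0 _ _ _); lia.
by apply: afil_le (afilM IH hy); lia.
Qed.

(** The leading terms of the images of [z^n] and [z^n zeta] are [a^n z^n] and [a^n d z^n zeta]. The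
    orders are those that put [Z - a z] in level 2 and [T - d zeta] in level 1, which is why [Z.2]
    starts in degree 2 and [T.1] in degree 1. *)
Lemma subst_triangular (Z W T : A) b c (tZ : tnilp Z) :
  aeven Z -> aodd T -> Z * W = 1 -> W * Z = 1 ->
  lfil 1 Z.1 -> lfil 2 Z.2 -> lfil 1 T.1 -> lfil 0 T.2 ->
  Z.1 1 * b = 1 -> b * Z.1 1 = 1 -> T.2 0 * c = 1 -> c * T.2 0 = 1 ->
  ahomeo (asubst W T tZ).
Proof.
move=> eZ oT ZW WZ Z1 Z2 T1 T2; set a := Z.1 1; set d := T.2 0 => ab ba dc cd.
have lZ : lead Z a 1.
  split=> n hn; rewrite !coefE.
    by case: eqP => [->|ne]; rewrite ?subrr // subr0 Z1 //; lia.
  by rewrite subr0 Z2 //; lia.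
have lW : lead W b (-1) by exact: lead_inv lZ ab WZ.
have lz n : lead (zpow Z W n) (zpow a b n) n.
  case: n => k /=; first by rewrite -[Posz k]mul1r; exact: leadX.
  by rewrite NegzE -mulN1r; exact: leadX.
have lT : afil 1 (T - m1 d 0).
  split=> n hn; rewrite !coefE.
    by rewrite subr0 T1 //; lia.
  by case: eqP => [->|ne]; rewrite ?subrr // subr0 T2 //; lia.
have hT : afil 0 T.
  by rewrite -[T](subrK (m1 d 0)); apply: afilD; [apply: afil_le lT|exact: afil_m1].
have cst (r : R) P (x : A) : afil P x -> afil P (m0 r 0 * x).
  by move=> h; rewrite -[P]add0r; apply: afilM => //; exact: afil_m0.
apply: (@graded_homeo _ (zpow a b) (fun n => zpow a b n * d) (zpow b a) (fun n => c * zpow b a n)).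
- exact: acont_subst.
- move=> P x hx; apply: acvg_fil (asubst_cvg W T tZ x) _ => n; apply: afil_sum => i _.
  have [lt|ge] := ltP (i%:Z - n%:Z) P.
    by rewrite sterm0 ?hx.1 ?hx.2 //; exact: afil0.
  apply: afilD; apply: cst; first exact: afil_le ge (lead_fil (lz _)).
  by rewrite -[P]addr0; apply: afilM => //; exact: afil_le ge (lead_fil (lz _)).
- move=> r P; rewrite asubst_m0.
  have -> : m0 (r * zpow a b P) P = m0 r 0 * m0 (zpow a b P) P by rewrite m0M add0r.
  by rewrite -mulrBr; apply: cst; exact: lz.
- move=> r P; rewrite asubst_m1.
  have -> : m1 (r * (zpow a b P * d)) P = m0 r 0 * (m0 (zpow a b P) P * m1 d 0).
    by rewrite !m0M1 addr0 add0r.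
  rewrite -mulrBr; apply: cst.
  have -> : zpow Z W P * T - m0 (zpow a b P) P * m1 d 0 =
      (zpow Z W P - m0 (zpow a b P) P) * T + m0 (zpow a b P) P * (T - m1 d 0).
    by rewrite mulrBl mulrBr subrKA.
  apply: afilD; first by rewrite -[P + 1]addr0; apply: afilM => //; exact: lz.
  by apply: afilM => //; exact: afil_m0.
- by move=> P; exact: zpowV.
- by move=> P; exact: zpowV.
- by move=> P; rewrite mulrA -[_ * d * c]mulrA dc mulr1 zpowV.
- by move=> P; rewrite mulrA -[c * _ * _]mulrA zpowV // mulr1.
Qed.

End Triangular.

(** * Invertibility of substitutions *)

Section SubstHomeo.
Variables (R : pzRingType) (ev od : {additive R -> R}) (HR : superring ev od).
Local Coercion lcoef : laurent >-> Funclass.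
Local Notation A := (superL HR).
Local Notation m0 := (m0 HR).
Local Notation m1 := (m1 HR).
Implicit Types (x y z w l Z W T : A) (F G : A -> A) (p : A * A).

(** The nilpotency conditions address the even coefficients; those of [Z.2] and [T.1] are odd and
    thus square-zero. *)
Definition sgood Z T :=
  [/\ aeven Z, aodd T, forall n, n < 1 -> rnilp (Z.1 n) &
      forall n, n < 0 -> rnilp (T.2 n)] /\
  [/\ exists2 b, is_even ev b & Z.1 1 * b = 1 &
      exists2 c, is_even ev c & T.2 0 * c = 1].

(** Quantifying over the inverse and the nilpotency proof makes this a property of the pair alone,
    which can be transported when a coefficient changes. *)
Definition shomeo Z T := forall W (tZ : tnilp Z), aeven W -> Z * W = 1 ->
  W * Z = 1 -> ahomeo (asubst W T tZ).

Lemma sgood_unit Z T : sgood Z T -> exists2 W, aeven W & Z * W = 1 /\ W * Z = 1.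
Proof.
by move=> [[e _ n _] [[b eb hb] _]]; have [W [? ? ?]] := unit_of_nilp e n eb hb; exists W.
Qed.

Lemma shomeo_perturb Z T Z' T' r : sgood Z T -> sgood Z' T' -> homog ev od r ->
  rnilp r -> coefin r (Z - Z') -> coefin r (T - T') -> shomeo Z' T' -> shomeo Z T.
Proof.
move=> gp gq hr [k rk] h1 h2 hq W tZ eW ZW WZ; have [W' eW' [ZW' WZ']] := sgood_unit gq.
case: gp gq => [[ep op _ _] _] [[eq oq nq _] _].
have tZ' : tnilp Z' by exact: tnilp_of_nilp.
apply: (@ahomeo_perturb _ _ _ _ _ (asubst W' T' tZ') r k) => //.
- exact: acont_subst.
- by move=> c x; exact: asubst_cst.
- exact: acont_subst.
- by move=> c x; exact: asubst_cst.
- exact: hq.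
- move=> x; apply: coefin_div; apply: (coefin_subst hr) => //.
    by rewrite -opprB; exact: coefinN.
  by rewrite -opprB; exact: coefinN.
Qed.

(** Induction on the number of degrees below [B] that the component [comp] may occupy. [G] is an
    invariant kept by each removal, and the goal [Q] is pulled back along removals. *)
Lemma peel_ind (G Q : A * A -> Prop) (comp : A * A -> laurent R)
    (pe : A * A -> int -> A * A) (B : int) :
  (forall p m, G p -> m < B -> G (pe p m)) ->
  (forall p m, G p -> m < B -> Q (pe p m) -> Q p) ->
  (forall p m n, comp (pe p m) n = if n == m then 0 else comp p n) ->
  (forall p, G p -> lfil B (comp p) -> Q p) -> forall p, G p -> Q p.
Proof.
move=> Gpe Qpe compE base p0 Gp0.
suff H (k : nat) p : G p -> lfil (B - k%:Z) (comp p) -> Q p.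
  apply: (H (absz (B - lbound (comp p0))%R)) => //.
  by apply: lfil_le (@lfil_bound _ _); lia.
elim: k p => [|k IH] p Gp fp; first by apply: base => //; rewrite -[B]subr0.
have lt : B - k.+1%:Z < B by lia.
apply: (Qpe _ _ Gp lt); apply: IH; first exact: Gpe.
move=> n hn; rewrite compE; case: eqP => // ne; apply: fp; lia.
Qed.

Lemma rnilp0 : rnilp (0 : R). Proof. by exists 1%N; rewrite expr1. Qed.
Lemma rnilp_odd r : is_odd od r -> rnilp r.
Proof. by move=> h; exists 2%N; rewrite expr2 (odd_sqr HR). Qed.

Lemma sgood_peel Z T Z' T' : sgood Z T -> aeven Z' -> aodd T' ->
  (forall n, n < 1 -> rnilp (Z'.1 n)) -> (forall n, n < 0 -> rnilp (T'.2 n)) ->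
  Z'.1 1 = Z.1 1 -> T'.2 0 = T.2 0 -> sgood Z' T'.
Proof. by move=> [_ u] e o n1 n2 e1 e2; split; rewrite ?e1 ?e2. Qed.

Lemma sgood_peel_Z1 Z T m : sgood Z T -> m < 1 -> sgood (Z - m0 (Z.1 m) m) T.
Proof.
move=> g hm; have [[e o n1 n2] _] := g; apply: sgood_peel g _ _ _ _ _ _ => //.
- by apply: aevenD => //; apply: aevenN; apply: aeven_m0; exact: e.1.
- move=> n hn; rewrite !coefE; case: eqP => [->|_]; last by rewrite subr0; exact: n1.
  by rewrite subrr; exact: rnilp0.
- by rewrite !coefE; case: eqP => [E|_]; [lia|rewrite subr0].
Qed.

Lemma sgood_peel_Z2 Z T m : sgood Z T -> sgood (Z - m1 (Z.2 m) m) T.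
Proof.
move=> g; have [[e o n1 n2] _] := g; apply: sgood_peel g _ _ _ _ _ _ => //.
- by apply: aevenD => //; apply: aevenN; apply: aeven_m1; exact: e.2.
- by move=> n hn; rewrite !coefE subr0; exact: n1.
- by rewrite !coefE subr0.
Qed.

Lemma sgood_peel_T1 Z T m : sgood Z T -> sgood Z (T - m0 (T.1 m) m).
Proof.
move=> g; have [[e o n1 n2] _] := g; apply: sgood_peel g _ _ _ _ _ _ => //.
- by apply: aoddD => //; apply: aoddN; apply: aodd_m0_odd; exact: o.1.
- by move=> n hn; rewrite !coefE subr0; exact: n2.
- by rewrite !coefE subr0.
Qed.

Lemma sgood_peel_T2 Z T m : sgood Z T -> m < 0 -> sgood Z (T - m1 (T.2 m) m).
Proof.
move=> g hm; have [[e o n1 n2] _] := g; apply: sgood_peel g _ _ _ _ _ _ => //.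
- by apply: aoddD => //; apply: aoddN; apply: aodd_m1; exact: o.2.
- move=> n hn; rewrite !coefE; case: eqP => [->|_]; last by rewrite subr0; exact: n2.
  by rewrite subrr; exact: rnilp0.
- by rewrite !coefE; case: eqP => [E|_]; [lia|rewrite subr0].
Qed.

(* Finitely many homogeneous nilpotent coefficients separate a good pair from a
   triangular one; they are removed one at a time. *)
Theorem sgood_shomeo Z T : sgood Z T -> shomeo Z T.
Proof.
have c0 r x : coefin r (x - x) by rewrite subrr; exact: coefin0.
have cD r x y : coefin r y -> coefin r (x - (x - y)) by rewrite subKr.
pose Q p := shomeo p.1 p.2.
pose G0 p := sgood p.1 p.2.
(* The orders are those of [subst_triangular]: degree 1 of [Z.1] and degree 0 of [T.2] hold the
   units and are kept, while the odd components are cleared below degrees 2 and 1. Each predicate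
   retains the preceding ones, so later removals must not disturb earlier ones. *)
pose G1 p := G0 p /\ lfil 1 p.1.1.
pose G2 p := G1 p /\ lfil 2 p.1.2.
pose G3 p := G2 p /\ lfil 1 p.2.1.
suff H p : G0 p -> Q p by exact: (H (Z, T)).
move: p; apply: (@peel_ind _ _ (fun p => p.1.1) (fun p m => (p.1 - m0 (p.1.1 m) m, p.2)) 1).
- by move=> p m; exact: sgood_peel_Z1.
- move=> p m g hm; have [[e _ n1 _] _] := g.
  apply: (shomeo_perturb g (sgood_peel_Z1 g hm) _ (n1 m hm)) => //.
    by left; exact: e.1.
  by apply: cD; exact: coefin_m0.
- move=> p m n; rewrite [lcoef _ _]fst_coefB fst_m0.
  by case: eqP => [->|_]; rewrite ?subrr ?subr0.
move=> p g f; have {g f} : G1 p by [].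
have G1pe q m : G1 q -> G1 (q.1 - m1 (q.1.2 m) m, q.2).
  move=> [g f]; split; first exact: sgood_peel_Z2.
  by move=> n hn; rewrite [lcoef _ _]fst_coefB fst_m1 subr0; exact: f.
move: p; apply: (@peel_ind _ _ (fun p => p.1.2) (fun p m => (p.1 - m1 (p.1.2 m) m, p.2)) 2).
- by move=> q m g _; exact: G1pe.
- move=> q m g _; have [[e _ _ _] _] := g.1.
  apply: (shomeo_perturb g.1 (G1pe q m g).1 _ (rnilp_odd (e.2 m))) => //.
    by right; exact: e.2.
  by apply: cD; exact: coefin_m1.
- move=> p m n; rewrite [lcoef _ _]snd_coefB snd_m1.
  by case: eqP => [->|_]; rewrite ?subrr ?subr0.
move=> p g f; have {g f} : G2 p by [].
have G2pe q m : G2 q -> G2 (q.1, q.2 - m0 (q.2.1 m) m).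
  by move=> [[g f1] f2]; split=> //; split=> //; exact: sgood_peel_T1.
move: p; apply: (@peel_ind _ _ (fun p => p.2.1) (fun p m => (p.1, p.2 - m0 (p.2.1 m) m)) 1).
- by move=> q m g _; exact: G2pe.
- move=> q m g _; have [[_ o _ _] _] := g.1.1.
  apply: (shomeo_perturb g.1.1 (G2pe q m g).1.1 _ (rnilp_odd (o.1 m))) => //.
    by right; exact: o.1.
  by apply: cD; exact: coefin_m0.
- move=> p m n; rewrite [lcoef _ _]fst_coefB fst_m0.
  by case: eqP => [->|_]; rewrite ?subrr ?subr0.
move=> p g f; have {g f} : G3 p by [].
have G3pe q m : m < 0 -> G3 q -> G3 (q.1, q.2 - m1 (q.2.2 m) m).
  move=> hm [[[g f1] f2] f3]; split; first by split=> //; split=> //; exact: sgood_peel_T2.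
  by move=> n hn; rewrite [lcoef _ _]fst_coefB fst_m1 subr0; exact: f3.
move: p; apply: (@peel_ind _ _ (fun p => p.2.2) (fun p m => (p.1, p.2 - m1 (p.2.2 m) m)) 0).
- by move=> q m g hm; exact: G3pe.
- move=> q m g hm; have [[_ o _ n2] _] := g.1.1.1.
  apply: (shomeo_perturb g.1.1.1 (G3pe q m hm g).1.1.1 _ (n2 m hm)) => //.
    by left; exact: o.2.
  by apply: cD; exact: coefin_m1.
- move=> p m n; rewrite [lcoef _ _]snd_coefB snd_m1.
  by case: eqP => [->|_]; rewrite ?subrr ?subr0.
move=> p [[[[[e o n1 n2] [[b eb hb] [c ec hc]]] f1] f2] f3] f4 W tZ eW ZW WZ.
apply: (@subst_triangular _ _ _ _ _ _ _ b c) => //.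
  by rewrite (even_commr HR).
by rewrite (even_commr HR).
Qed.

End SubstHomeo.

(** * Coefficients modulo nilpotents *)

Section NilIdeal.
Variables (R : pzRingType) (ev od : {additive R -> R}) (HR : superring ev od).
Local Coercion lcoef : laurent >-> Funclass.
Implicit Types (a b c d : R) (u v eta : laurent R).

Lemma rnilpD c d : c * d = d * c -> rnilp c -> rnilp d -> rnilp (c + d).
Proof.
move=> cd [j cj] [k dk]; exists (j + k)%N; rewrite exprDn_comm // big1 // => i _.
have [le|lt] := leqP k i.
  by rewrite -(subnK le) [d ^+ _]exprD dk !mulr0 mul0rn.
have le : (j <= j + k - i)%N by lia.
by rewrite -(subnK le) [c ^+ _]exprD cj mulr0 mul0r mul0rn.
Qed.

Lemma rnilpM c d : c * d = d * c -> rnilp c -> rnilp (c * d).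
Proof. by move=> cd [k ck]; exists k; rewrite exprMn_comm // ck mul0r. Qed.

(* An ideal with reduced commutative quotient, containing every odd element. *)
Definition nilideal c := rnilp (ev c).

Lemma nilideal0 : nilideal 0. Proof. by rewrite /nilideal raddf0; exact: rnilp0. Qed.
Lemma nilidealD c d : nilideal c -> nilideal d -> nilideal (c + d).
Proof.
rewrite /nilideal raddfD; apply: rnilpD; apply: (even_commr HR); exact: (ev_even HR).
Qed.
Lemma nilideal_odd c : is_odd od c -> nilideal c.
Proof. by move=> h; rewrite /nilideal (odd_ev0 HR h); exact: rnilp0. Qed.
Lemma nilidealE c : is_even ev c -> nilideal c <-> rnilp c.
Proof. by rewrite /nilideal => ->. Qed.
(** The even part of [c d] is a multiple of the nilpotent [ev c] plus [od c * od d], which squares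
    to zero by anticommutation. *)
Lemma nilidealMr c d : nilideal c -> nilideal (c * d).
Proof.
move=> hc; rewrite /nilideal (evM HR).
have ee := ev_even HR; have oo := od_odd HR.
apply: rnilpD.
- by apply: (even_commr HR); apply: (even_mul HR).
- by apply: rnilpM => //; exact: (even_commr HR).
- exists 2%N; rewrite expr2 {2}(sr_odd_anticomm HR c d) mulrN -mulrA.
  by rewrite [od d * (_ * _)]mulrA (odd_sqr HR (oo d)) mul0r mulr0 oppr0.
Qed.
Lemma nilidealMl c d : nilideal c -> nilideal (d * c).
Proof.
move=> hc; rewrite -(sr_decomp HR d) mulrDl; apply: nilidealD.
  by rewrite (even_commr HR _ (ev_even HR d)); exact: nilidealMr.
by apply: nilidealMr; apply: nilideal_odd; exact: (od_odd HR).
Qed.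
Lemma nilidealN c : nilideal c -> nilideal (- c).
Proof. by rewrite -mulN1r; exact: nilidealMl. Qed.
Lemma nilidealB c d : nilideal c -> nilideal d -> nilideal (c - d).
Proof. by move=> hc hd; apply: nilidealD => //; exact: nilidealN. Qed.
Lemma nilideal_sum (I : Type) (r : seq I) (P : pred I) (F : I -> R) :
  (forall i, P i -> nilideal (F i)) -> nilideal (\sum_(i <- r | P i) F i).
Proof. by move=> h; apply: big_ind => //; [exact: nilideal0|exact: nilidealD]. Qed.

(** [c d = 1 - e] with [e] nilpotent, so a finite geometric series provides the inverse. *)
Lemma unit_mod_nil c d : is_even ev c -> is_even ev d -> nilideal (1 - c * d) ->
  exists2 b, is_even ev b & c * b = 1.
Proof.
move=> ec ed /nilidealE; case.
  by apply: evenD; [exact: (even1 HR)|apply: evenN; exact: (even_mul HR)].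
set e := 1 - c * d => k ek; have ee : is_even ev e.
  by apply: evenD; [exact: (even1 HR)|apply: evenN; exact: (even_mul HR)].
exists (d * \sum_(i < k) e ^+ i).
  apply: (even_mul HR) => //; apply: (big_ind (is_even ev)) => [|x y|i _].
  - exact: even0.
  - exact: evenD.
  - exact: (even_exp HR).
rewrite mulrA (_ : c * d = - (e - 1)); last by rewrite /e opprB subKr.
by rewrite mulNr -subrX1 ek sub0r opprK.
Qed.

(** Modulo the ideal [u] has order at least 1, so [u^k] has order at least [k]. *)
Lemma nilideal_expr u k : (forall n, n < 1 -> nilideal (u n)) ->
  forall n, n < k%:Z -> nilideal (lcoef (u ^+ k) n).
Proof.
move=> hu; elim: k => [|k IH] n hn.
  by rewrite expr0 [lcoef _ _]lcoef_mono ifN ?lt_eqF //; exact: nilideal0.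
rewrite exprS; apply: lcoefM_in => [|x y|i]; [exact: nilideal0|exact: nilidealD|].
have [lt|ge] := ltP i 1; first by apply: nilidealMr; exact: hu.
by apply: nilidealMl; apply: IH; lia.
Qed.

(** Modulo the ideal [v^2 = u'] has no negative degrees. If all [v_i] with [i < m] vanish there, the
    coefficient of [v^2] in degree [2 m] is [v_m^2]; for [m < 0] it vanishes, hence so does [v_m] in
    the reduced quotient. Degree 0 then gives [v_0^2] congruent to [u_1]. *)
Lemma sqrt_good u eta v b : (forall n, n < 1 -> nilideal (u n)) -> lodd od eta ->
  leven ev v -> is_even ev b -> u 1 * b = 1 ->
  v * v = lder u + eta * lder eta ->
  (forall n, n < 0 -> rnilp (v n)) /\ exists2 c, is_even ev c & v 0 * c = 1.
Proof.
move=> hu oe ev_v eb ub E.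
have he n : nilideal (lcoef (eta * lder eta) n).
  apply: lcoefM_in => [|x y|i]; [exact: nilideal0|exact: nilidealD|].
  by apply: nilidealMr; exact: nilideal_odd.
have vv n : n < 0 -> nilideal (lcoef (v * v) n).
  move=> hn; rewrite E lcoefD; apply: nilidealD => //.
  rewrite [lcoef _ _](_ : _ = u (n + 1) * 1 *~ (n + 1)); last by rewrite mulr1.
  by rewrite -mulrzAr; apply: nilidealMr; apply: hu; lia.
have sq n : nilideal (v n * v n) -> nilideal (v n).
  move=> /nilidealE[]; first exact: (even_mul HR).
  move=> k hk; apply/nilidealE => //; exists (k + k)%N.
  by rewrite exprD -exprMn_comm.
have vn n : n < 0 -> nilideal (v n).
  suff H (k : nat) m : m < lbound v + k%:Z -> m < 0 -> nilideal (v m).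
    by apply: (H (absz (n - lbound v)%R).+1); lia.
  elim: k m => [|k IH] m hm hm0; first by rewrite lboundP; [exact: nilideal0|lia].
  apply: sq; rewrite -[v m * v m](subKr (lcoef (v * v) (m + m))).
  apply: nilidealB; first by apply: vv; lia.
  rewrite -{4}[m](addrK m m); apply: lcoefM_lead => [|x y|i /eqP ne].
  - exact: nilideal0.
  - exact: nilidealD.
  have [lt|ge] := ltP i m; first by apply: nilidealMr; apply: IH; lia.
  by apply: nilidealMl; apply: IH; lia.
split=> [n hn|]; first by apply/nilidealE => //; exact: vn.
have n0 : nilideal (u 1 - v 0 * v 0).
  have h : nilideal (lcoef (v * v) 0 - v 0 * v (0 - 0)).
    apply: lcoefM_lead => [|x y|i /eqP ne]; [exact: nilideal0|exact: nilidealD|].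
    have [lt|ge] := ltP i 0; first by apply: nilidealMr; exact: vn.
    by apply: nilidealMl; apply: vn; lia.
  have := nilidealB h (he 0); rewrite E lcoefD; congr nilideal.
  by rewrite subr0 addrAC addrK.
(* The approximate inverse of [v_0] is [v_0 b], because [v_0^2 b] is congruent to [u_1 b = 1]. *)
apply: (@unit_mod_nil (v 0) (v 0 * b)) => //; first exact: (even_mul HR).
by rewrite -ub mulrA -mulrBl; exact: nilidealMr.
Qed.

End NilIdeal.

(** * Continuous homomorphisms and the images of the generators *)

Section ContinuousHom.
Variables (R : pzRingType) (ev od : {additive R -> R}) (HR : superring ev od).
Local Coercion lcoef : laurent >-> Funclass.
Local Notation A := (superL HR).
Local Notation m0 := (m0 HR).
Local Notation m1 := (m1 HR).
Implicit Types (x y Z W T : A) (phi psi : A -> A).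

Definition chom phi := [/\ acont phi, alinear phi,
  forall x y, phi (x * y) = phi x * phi y & phi 1 = 1].

Lemma m0_zpow k : zpow (m0 1 1) (m0 1 (-1)) k = m0 1 k.
Proof. by case: k => k /=; rewrite m0X expr1n ?mul1r // mulN1r NegzE. Qed.

Lemma chom_m0 phi r k : chom phi ->
  phi (m0 r k) = m0 r 0 * zpow (phi (m0 1 1)) (phi (m0 1 (-1))) k.
Proof.
move=> [_ l M o]; rewrite -(zpow_morph _ _ _ M o) m0_zpow -l m0M.
by rewrite mulr1 add0r.
Qed.

Lemma chom_m1 phi r k : chom phi ->
  phi (m1 r k) = m0 r 0 * (zpow (phi (m0 1 1)) (phi (m0 1 (-1))) k * phi (m1 1 0)).
Proof.
move=> [_ l M o]; rewrite -(zpow_morph _ _ _ M o) m0_zpow -M -l !m0M1.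
by rewrite !mulr1 add0r addr0.
Qed.

Lemma chom_inv phi : chom phi ->
  phi (m0 1 1) * phi (m0 1 (-1)) = 1 /\ phi (m0 1 (-1)) * phi (m0 1 1) = 1.
Proof.
by move=> [_ _ M o]; rewrite -!M !m0M !mulr1 subrr addNr.
Qed.

(** The image of [z^-1] is the inverse of that of [z], so the two given images determine all
    monomials. *)
Lemma chom_ext phi psi : chom phi -> chom psi ->
  phi (m0 1 1) = psi (m0 1 1) -> phi (m1 1 0) = psi (m1 1 0) -> phi =1 psi.
Proof.
move=> h h' ez et; have [a1 a2] := chom_inv h; have [b1 b2] := chom_inv h'.
have ew : phi (m0 1 (-1)) = psi (m0 1 (-1)).
  by rewrite -[LHS]mulr1 -b1 mulrA -ez a2 mul1r.
case: (h) (h') => c _ _ _ [c' _ _ _]; apply: acont_ext => // r k.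
  by rewrite (chom_m0 r k h) (chom_m0 r k h') ez ew.
by rewrite (chom_m1 r k h) (chom_m1 r k h') ez ew et.
Qed.

Lemma chom_tnilp phi : chom phi -> tnilp (phi (m0 1 1)).
Proof.
move=> [[D c] _ M o] P; have [N hN] := c P; exists (absz N) => n hn.
have -> : phi (m0 1 1) ^+ n = phi (m0 1 1 ^+ n).
  by elim: n {hn} => [|n IH]; rewrite ?expr0 // !exprS M IH.
apply: hN; rewrite m0X mul1r; apply: afil_le (afil_m0 _ _ _); lia.
Qed.

Lemma chom_subst Z W T (tZ : tnilp Z) : aeven Z -> aeven W -> aodd T ->
  Z * W = 1 -> W * Z = 1 -> chom (asubst W T tZ).
Proof.
move=> *; split; [exact: acont_subst|by move=> r x; exact: asubst_cst
  |by move=> x y; exact: asubstM|exact: asubst1].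
Qed.

(* Compare the coefficients of [z] in [phi (psi z) = z] modulo [nilideal]. *)
Lemma chom_unit phi psi : chom phi -> chom psi -> cancel psi phi ->
  aeven (phi (m0 1 1)) -> aeven (phi (m0 1 (-1))) -> aodd (phi (m1 1 0)) ->
  aeven (psi (m0 1 1)) ->
  exists2 b, is_even ev b & (phi (m0 1 1)).1 1 * b = 1.
Proof.
move=> h h' can eZ eW oT ex; set Z := phi (m0 1 1); set W := phi (m0 1 (-1)).
set T := phi (m1 1 0); set x := psi (m0 1 1).
have [ZW WZ] := chom_inv h; have tZ : tnilp Z by exact: chom_tnilp.
have E : phi =1 asubst W T tZ.
  apply: chom_ext => //; first exact: chom_subst.
    by rewrite asubst_z.
  by rewrite asubst_zeta.
have nZ n : n < 1 -> nilideal ev (Z.1 n).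
  move=> hn; apply/(nilidealE (eZ.1 n)); exact: nilp_of_tnilp.
have nx n : n < 1 -> nilideal ev (x.1 n).
  move=> hn; apply/(nilidealE (ex.1 n)); apply: nilp_of_tnilp => //; exact: chom_tnilp.
(* Terms with [n < 1] carry the nilpotent [x_n]; those with [n > 1] carry the coefficient of [z] in
   the [n]-th power of [Z.1], which lies in the ideal. Only the term [n = 1] survives modulo the
   ideal. *)
have n1 n : n != 1 -> nilideal ev ((sterm Z W T x n).1 1).
  move=> ne; have -> : (sterm Z W T x n).1 1 =
      x.1 n * (zpow Z W n).1 1 + x.2 n * (zpow Z W n * T).1 1.
    by rewrite /sterm fst_coefD !fstM !lcoef_monoM subr0.
  apply: (nilidealD HR); last first.
    by apply: (nilidealMr HR); apply: (nilideal_odd HR); exact: ex.2.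
  have [lt|ge] := ltP n 1; first by apply: (nilidealMr HR); exact: nx.
  apply: (nilidealMl HR); case: n ne ge => [k|k] ne ge; last by lia.
  by rewrite /= fstX; apply: (nilideal_expr HR) => //; lia.
apply: (@unit_mod_nil _ _ _ HR _ (x.1 1)); [exact: eZ.1|exact: ex.1|].
have [M hM] : exists M, forall n, (M <= n)%N -> (spsum Z W T x n).1 1 = 1.
  have [M hM] := acvg_coef 1 (asubst_cvg W T tZ x); exists M => n /hM[-> _].
  by rewrite -E can fst_m0 eqxx.
(* After the shift by [n] the index [n.+1] stands for degree 1; [n >= 2] places it inside the window
   of length [2 n]. *)
set n := maxn M 2; have := hM n (leq_maxl _ _).
have hi : (n.+1 < n.*2)%N by rewrite /n; lia.
rewrite /spsum (bigD1 (Ordinal hi)) // fst_coefD => e1.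
have e : (Ordinal hi : nat)%:Z - n%:Z = 1 by rewrite /=; lia.
rewrite e in e1; rewrite -[X in nilideal ev (X - _)]e1 addrAC; apply: (nilidealD HR); last first.
  rewrite [X in nilideal ev X](_ : _ = \sum_(i < n.*2 | i != Ordinal hi)
     (sterm Z W T x (i%:Z - n%:Z)).1 1).
    apply: (nilideal_sum HR) => i /eqP ne; apply: n1; apply/eqP => e2; apply: ne.
    by apply: val_inj => /=; lia.
  by elim/big_rec2: _ => [|i y1 y2 _ <-]; [exact: lcoef0|].
have -> : (sterm Z W T x 1).1 1 = x.1 1 * Z.1 1 + x.2 1 * (Z * T).1 1.
  by rewrite /sterm fst_coefD !fstM !lcoef_monoM subr0.
rewrite (even_commr HR _ (eZ.1 1)) addrAC subrr add0r.
by apply: (nilidealMr HR); apply: (nilideal_odd HR); exact: ex.2.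
Qed.

End ContinuousHom.

(** * Superconformal automorphisms *)

Section Superconformal.
Variables (R : pzRingType) (ev od : {additive R -> R}) (HR : superring ev od).
Local Coercion lcoef : laurent >-> Funclass.
Local Notation A := (superL HR).
Local Notation sg := (lsig ev od).
Local Notation m0 := (m0 HR).
Local Notation m1 := (m1 HR).
Implicit Types (x y Z W T : A) (phi psi : A -> A).

(** The twist [sg] comes from moving [zeta] in [zeta eta] to the right of its coefficient. *)
Lemma psiSE phi : psiS ev od phi =
  (((phi (m0 1 1)).1, sg (phi (m1 1 0)).1), sg (phi (m1 1 0)).2).
Proof.
congr pair; set u := (phi (m0 1 1)).1; set eta := (phi (m1 1 0)).1.
rewrite [LHS](_ : _ = ((u, 0) : A) + m1 1 0 * ((eta, 0) : A)) //.
apply: superL_eq; rewrite ?fstD ?sndD ?fstM ?sndM /= ?mul0r ?addr0 //.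
by rewrite !add0r [mono 1 0 * _]mul1r.
Qed.

Lemma even_odd_eq0 x : aeven x -> aodd x -> x = 0.
Proof.
have z c : is_even ev c -> is_odd od c -> c = 0 by move=> e <-; exact: (even_od0 HR e).
by move=> [e1 e2] [o1 o2]; apply: superL_eq; apply: laurentP => n; rewrite lcoef0;
  exact: z.
Qed.

Lemma even_odd_dec x : exists y z : A, [/\ aeven y, aodd z & x = y + z].
Proof.
have se (f : laurent R) : f = lmap ev f + lmap od f.
  by apply: laurentP => n; rewrite lcoefD /= (sr_decomp HR).
exists (lmap ev x.1, lmap od x.2), (lmap od x.1, lmap ev x.2); split.
- by split=> n /=; [exact: (ev_even HR)|exact: (od_odd HR)].
- by split=> n /=; [exact: (od_odd HR)|exact: (ev_even HR)].
- by apply: superL_eq; [exact: se | apply: etrans (se x.2) _; exact: addrC].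
Qed.

Lemma acontP phi : acont phi <->
  (forall x y, phi (ls_add x y) = ls_add (phi x) (phi y)) /\ ls_continuous phi.
Proof.
by split=> -[D c]; split=> // M; have [N hN] := c M; exists N => x /afilE h;
  apply/afilE; exact: hN.
Qed.

Lemma SWittP phi : SWitt ev od phi <->
  [/\ chom phi, forall x, aeven x -> aeven (phi x), forall x, aodd x -> aodd (phi x) &
      exists psi, [/\ cancel phi psi, cancel psi phi, ls_continuous psi &
        exists F : A, forall x, psi (aD (phi x)) = F * aD x]].
Proof.
split.
  move=> [D [l [M [o [e [od_ [c [psi [k1 [k2 [c' [F hF]]]]]]]]]]]].
  split=> //; last by exists psi; split=> //; exists F.
  split=> //; first exact/acontP.
  by move=> r x; rewrite !m0_scale.
move=> [[/acontP[D c] l M o] e od_ [psi [k1 k2 c' [F hF]]]].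
split=> //; split; first by move=> r x; have := l r x; rewrite !m0_scale.
do 5 (split=> //).
by exists psi; split=> //; split=> //; split=> //; exists F.
Qed.

(** The two components are [omega = eta v] and [v^2 = u' + eta eta']; [sg] appears because [Z.2] is
    the coefficient to the left of [zeta] whereas [omega] stands to its right. *)
Lemma superconformal_coords Z T : aeven Z -> aodd T ->
  aD Z = T * aD T <-> Z.2 = sg (T.1 * T.2) /\ T.2 * T.2 = lder Z.1 + T.1 * lder T.1.
Proof.
move=> [e1 e2] [o1 o2].
have s2 : (T * aD T).2 = - (T.1 * lder T.1) + T.2 * T.2.
  by rewrite sndM fst_aD snd_aD (lsig_odd HR (lodd_der o1)) mulrN (lsigK HR).
have s1 : (T * aD T).1 = T.1 * T.2 by rewrite fstM fst_aD (lsig_even HR o2).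
split=> [E|[E1 E2]].
  split; first by rewrite -s1 -E fst_aD (lsigK HR).
  have := congr1 snd E; rewrite s2 snd_aD (lsig_even HR (leven_der e1)) => ->.
  by rewrite addrAC addNr add0r.
apply: superL_eq; first by rewrite s1 fst_aD E1 (lsigK HR).
by rewrite s2 snd_aD (lsig_even HR (leven_der e1)) E2 addrCA addNr addr0.
Qed.

Lemma even_z k : aeven (m0 1 k). Proof. by apply: aeven_m0; exact: (even1 HR). Qed.
Lemma odd_zeta : aodd (m1 1 0). Proof. by apply: aodd_m1; exact: (even1 HR). Qed.

(** Evaluating [psi D phi = F D] at [zeta], where [D zeta = 1], identifies [F] as [psi (D T)].
    Evaluating it at [z], where [D z = zeta], and applying [phi] gives [D Z = (D T) T], with [D T]
    even and hence central. *)
Lemma SWitt_superconformal phi : SWitt ev od phi ->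
  aD (phi (m0 1 1)) = phi (m1 1 0) * aD (phi (m1 1 0)).
Proof.
move=> /SWittP[[_ _ M o] e od_ [psi [k1 k2 _ [F hF]]]].
have F1 : F = psi (aD (phi (m1 1 0))).
  by rewrite hF aD_m1 (spar_even HR (even1 HR)) mulr1.
have h := hF (m0 1 1); rewrite aD_m0 (spar_even HR (even1 HR)) mulr1z in h.
move/(congr1 phi): h; rewrite k2 M F1 k2 => ->.
apply: aeven_comm; apply: aD_odd; apply: od_; exact: odd_zeta.
Qed.

Lemma SWitt_GammaTilde phi : SWitt ev od phi -> GammaTilde ev od (psiS ev od phi).
Proof.
move=> hphi; have E := SWitt_superconformal hphi.
move: hphi => /SWittP[h e o [psi [k1 k2 c' _]]]; case: (h) => cphi lphi Mphi phi1.
have eZ := e _ (even_z 1); have eW := e _ (even_z (-1)); have oT := o _ odd_zeta.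
have psih : chom psi.
  split.
  - apply/acontP; split=> // x y; apply: (can_inj k1); rewrite k2.
    by have -> := cphi.1 (psi x) (psi y); rewrite !k2.
  - by move=> r x; apply: (can_inj k1); rewrite lphi !k2.
  - by move=> x y; apply: (can_inj k1); rewrite Mphi !k2.
  - by rewrite -phi1 k1.
(* The inverse inherits parity: the odd part [z] of [psi x] has an image that is odd and also, as a
   difference of even elements, even. *)
have psie x : aeven x -> aeven (psi x).
  move=> ex; have [y [z [ey oz yz]]] := even_odd_dec (psi x).
  have z0 : phi z = 0.
    apply: even_odd_eq0; last exact: o.
    have -> : phi z = x - phi y by rewrite -[x]k2 yz cphi.1 addrC addKr.
    by apply: aevenD => //; apply: aevenN; exact: e.
  have -> : psi x = y by rewrite yz -[z]k1 z0 -(acont0 cphi) k1 addr0.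
  exact: ey.
have [b eb ub] := chom_unit h psih k2 eZ eW oT (psie _ (even_z 1)).
have [E1 E2] := (superconformal_coords eZ oT).1 E.
rewrite psiSE; split; [|split].
- split; [split|split]; [exact: eZ.1|exact: (lodd_sig HR oT.1)| |].
  + by exists b; split=> //; split=> //; rewrite (even_commr HR).
  + exact: (nilp_of_tnilp eZ (chom_tnilp h)).
- exact: (leven_sig HR oT.2).
- rewrite /= (lsig_even HR oT.2) /zcoef /= (lsigK HR).
  exact: E2.
Qed.

Lemma psiS_inj phi1 phi2 : SWitt ev od phi1 -> SWitt ev od phi2 ->
  psiS ev od phi1 = psiS ev od phi2 -> phi1 =1 phi2.
Proof.
move=> h1 h2; rewrite !psiSE => E; have eu := congr1 (fun p => p.1.1) E.
have eeta := congr1 (fun p => p.1.2) E; have ev_ := congr1 snd E.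
have E1 := SWitt_superconformal h1; have E2 := SWitt_superconformal h2.
move: h1 h2 => /SWittP[c1 e1 o1 _] /SWittP[c2 e2 o2 _].
have eT : phi1 (m1 1 0) = phi2 (m1 1 0).
  by apply: superL_eq; apply: (can_inj (lsigK HR)).
have [Z1 _] := (superconformal_coords (e1 _ (even_z 1)) (o1 _ odd_zeta)).1 E1.
have [Z2 _] := (superconformal_coords (e2 _ (even_z 1)) (o2 _ odd_zeta)).1 E2.
apply: chom_ext => //; apply: superL_eq => //; by rewrite Z1 Z2 eT.
Qed.

Lemma psiS_surj p : GammaTilde ev od p -> exists phi, SWitt ev od phi /\ psiS ev od phi = p.
Proof.
case: p => [[u h] v] [[[/= eu oh] [[b [eb [ub bu]]] nu]] [/= ev_v E]].
(* [h] stands to the left of [zeta] in the given pair, [eta] to its right. *)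
pose eta := sg h; rewrite /zcoef /= -/eta in E.
have oeta : lodd od eta by exact: (lodd_sig HR).
(* The odd component of [Z] is the value imposed by [superconformal_coords]. *)
pose Z : A := (u, sg (eta * v)); pose T : A := (eta, v).
have eZ : aeven Z by split=> //; apply: (lodd_sig HR); exact: (lodd_even_mul HR).
have oT : aodd T by split.
have [nv [c ec vc]] : (forall n, n < 0 -> rnilp (v n)) /\
    exists2 c, is_even ev c & v 0 * c = 1.
  by apply: (sqrt_good HR (u := u) (eta := eta) (b := b)) => // n hn;
    apply/(nilidealE (eu n)); exact: nu.
have good : sgood Z T by split; split=> //; [exists b|exists c].
have [W eW [ZW WZ]] := sgood_unit good.
have tZ : tnilp Z by exact: tnilp_of_nilp.
have [G [k1 k2 cG]] := sgood_shomeo good tZ eW ZW WZ.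
have DZ : aD Z = T * aD T by apply/(superconformal_coords eZ oT).
have hom := chom_subst tZ eZ eW oT ZW WZ; case: (hom) => _ _ Mphi _.
exists (asubst W T tZ); split.
  apply/SWittP; split=> //.
  - by move=> x; exact: asubst_even.
  - by move=> x; exact: asubst_odd.
  exists G; split=> //.
    by move=> M; have [N hN] := cG M; exists N => x /afilE hx; apply/afilE; exact: hN.
  (* This value of [F] is forced by evaluation at [zeta]; the chain rule [aD_subst] shows that it
     works on every element. *)
  exists (G (aD T)) => x; apply: (can_inj k1).
  by rewrite k2 Mphi k2 (aD_subst eZ) // [RHS]aeven_comm //; exact: aD_odd.
rewrite psiSE asubst_z asubst_zeta /= (lsigK HR) (lsig_even HR) //.
Qed.

End Superconformal.

Theorem mainTheorem14 (R : pzRingType) (ev od : {additive R -> R})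
    (HR : superring ev od) :
  (* psi_S lands in tilde Gamma^1_{0/2}(S) *)
  (forall phi, SWitt ev od phi -> GammaTilde ev od (psiS ev od phi)) /\
  (* injectivity *)
  (forall phi1 phi2, SWitt ev od phi1 -> SWitt ev od phi2 ->
     psiS ev od phi1 = psiS ev od phi2 -> forall x, phi1 x = phi2 x) /\
  (* surjectivity *)
  (forall p, GammaTilde ev od p -> exists phi, SWitt ev od phi /\ psiS ev od phi = p) /\
  (* naturality in S: compatibility with base change along even ring maps R -> R' *)
  (forall (R' : pzRingType) (ev' od' : {additive R' -> R'}), superring ev' od' ->
   forall f : {rmorphism R -> R'},
     (forall x, f (ev x) = ev' (f x)) -> (forall x, f (od x) = od' (f x)) ->
   forall phi phi', SWitt ev od phi -> SWitt ev' od' phi' ->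
     phi' (ls_z R') = mapLS f (phi (ls_z R)) ->
     phi' (ls_zeta R') = mapLS f (phi (ls_zeta R)) ->
     psiS ev' od' phi' = (mapLS f (psiS ev od phi).1, lmap f (psiS ev od phi).2)).
Proof.
split; first by move=> phi; exact: (@SWitt_GammaTilde _ _ _ HR).
split; first by move=> phi1 phi2; exact: (@psiS_inj _ _ _ HR).
split; first by move=> p; exact: (@psiS_surj _ _ _ HR).
move=> R' ev' od' HR' f fev fod phi phi' _ _ ez et.
(* With the images of the generators related by base change, naturality reduces to compatibility of
   the parity twist with [f]. *)
have sE (g : laurent R) : lsig ev' od' (lmap f g) = lmap f (lsig ev od g).
  by apply: laurentP => n; rewrite /= /spar rmorphB fev fod.
rewrite (@psiSE _ _ _ HR') (@psiSE _ _ _ HR) [phi' (m0 _ _ _)]ez [phi' (m1 _ _ _)]et /mapLS /=.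
by rewrite !sE.
Qed.
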